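(* Let $L$ be a pentagonal linkage charged by $(q_1,q_2,t,q_4,s)$ at its vertices $A_1,\dots,A_5$, where $q_1,q_2,q_4>0$ are fixed, with effective Coulomb potential $$E_{s,t}=\frac{q_1q_4}{|A_1A_4|}+\frac{q_2q_4}{|A_2A_4|}+\frac{q_1t}{|A_1A_3|}+\frac{q_2s}{|A_2A_5|}+\frac{st}{|A_3A_5|}.$$ Then for any starting configuration $P_0\in M^C(L)$ and any target configuration $P_1\in M^C(L)$ there exist a continuous path $\tau\mapsto(s(\tau),t(\tau))\in(\mathbb{R}_{>0})^2$, $\tau\in[0,1]$, and a continuous path $\tau\mapsto P(\tau)\in M^C(L)$ with $P(0)=P_0$, $P(1)=P_1$, such that for every $\tau$ the configuration $P(\tau)$ is the point of global minimum of $E_{s(\tau),t(\tau)}$ on $M(L)$.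
   Context: A pentagonal linkage $L$ is given by side lengths $a_1,\dots,a_5>0$; $M(L)$ is the set of planar 5-gons $(A_1,\dots,A_5)$ with $|A_iA_{i+1}|=a_i$ (indices mod 5) modulo all isometries of $\mathbb{R}^2$. $M^C(L)$ is the set of strictly convex configurations (convex pentagon $A_1\dots A_5$ in this cyclic order, no angle equal to $\pi$). *)

(* Defs.v *)
From Stdlib Require Import Reals Lra Arith.
Open Scope R_scope.

(* Points of the plane and configurations of 5 vertices.
   A configuration P : config uses indices 0..4 for the vertices A_1..A_5
   (A_{k} is P (k-1)); values at indices >= 5 are irrelevant. *)
Definition point := (R * R)%type.
Definition config := nat -> point.

Definition dist (p q : point) : R :=
  sqrt ((fst p - fst q) ^ 2 + (snd p - snd q) ^ 2).

Definition nxt (i : nat) : nat := ((i + 1) mod 5)%nat.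

(* P is a planar 5-gon with side lengths a_1..a_5 (a i = |A_{i+1} A_{i+2}|
   with 0-based i), i.e. a representative of a point of M(L). *)
Definition in_M (a : nat -> R) (P : config) : Prop :=
  forall i, (i < 5)%nat -> dist (P i) (P (nxt i)) = a i.

(* Isometries of R^2 and equality in M(L) (= modulo all isometries). *)
Definition isometry (f : point -> point) : Prop :=
  forall p q, dist (f p) (f q) = dist p q.

Definition congruent (P Q : config) : Prop :=
  exists f, isometry f /\ forall i, (i < 5)%nat -> f (P i) = Q i.

Definition cross (p q r : point) : R :=
  (fst q - fst p) * (snd r - snd p) - (snd q - snd p) * (fst r - fst p).

(* Strictly convex pentagon A_1 ... A_5 in this cyclic order, no angle = pi:
   for every edge A_i A_{i+1}, all other vertices lie strictly on the same
   side of the line A_i A_{i+1}, the side being the same for all edges. *)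
Definition strictly_convex (P : config) : Prop :=
  exists eps : R, (eps = 1 \/ eps = -1) /\
    forall i j, (i < 5)%nat -> (j < 5)%nat -> j <> i -> j <> nxt i ->
      eps * cross (P i) (P (nxt i)) (P j) > 0.

Definition in_MC (a : nat -> R) (P : config) : Prop :=
  in_M a P /\ strictly_convex P.

(* The five distances occurring in the potential are nonzero (otherwise the
   potential is +infinity). Vertices: A1=0, A2=1, A3=2, A4=3, A5=4. *)
Definition admissible (P : config) : Prop :=
  dist (P 0%nat) (P 3%nat) > 0 /\ dist (P 1%nat) (P 3%nat) > 0 /\
  dist (P 0%nat) (P 2%nat) > 0 /\ dist (P 1%nat) (P 4%nat) > 0 /\
  dist (P 2%nat) (P 4%nat) > 0.

Definition energy (q1 q2 q4 s t : R) (P : config) : R :=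
  q1 * q4 / dist (P 0%nat) (P 3%nat) + q2 * q4 / dist (P 1%nat) (P 3%nat)
  + q1 * t / dist (P 0%nat) (P 2%nat) + q2 * s / dist (P 1%nat) (P 4%nat)
  + s * t / dist (P 2%nat) (P 4%nat).

(* P is THE point of global minimum of E on M(L): every configuration of M(L)
   that is a different point of M(L) has strictly larger energy
   (configurations with a vanishing distance have energy +infinity). *)
Definition unique_global_min (a : nat -> R) (q1 q2 q4 s t : R) (P : config) : Prop :=
  in_M a P /\ admissible P /\
  forall Q, in_M a Q -> admissible Q -> ~ congruent P Q ->
    energy q1 q2 q4 s t P < energy q1 q2 q4 s t Q.

Definition cont01 (f : R -> R) : Prop :=
  forall x, 0 <= x <= 1 -> limit1_in f (fun y => 0 <= y <= 1) (f x) x.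

Definition path_cont01 (P : R -> config) : Prop :=
  forall i, (i < 5)%nat ->
    cont01 (fun tau => fst (P tau i)) /\ cont01 (fun tau => snd (P tau i)).

(* Main.v *)
From Stdlib Require Import Reals Lra Lia.
Require Import Defs.
Open Scope R_scope.

(* If [sum b_i = 0] and [sum b_i A_i = 0] at a configuration [P], then
   [- sum_(i<j) b_i b_j |Q_i - Q_j|^2 = |sum b_i Q_i|^2] is minimal at [Q = P], so on M(L) the sum of
   [b_i b_j |Q_i - Q_j|^2] over the diagonals is maximal at [P]. For a convex [P] take [b = nu], the
   dependency of the four vertices other than A_4, and [b = beta], the dependency whose entries at A_1
   and A_2 are the forces [q1 q4 / |A_1 A_4|^3] and [q2 q4 / |A_2 A_4|^3]; a combination
   [beta beta^T / beta_4 + lambda nu nu^T] with [lambda > 0] has on the diagonals exactly the Coulomb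
   coefficients [c_ij / |A_i A_j|^3] of some [s, t > 0], where [lambda] is the larger root of a
   quadratic equation. As [1 / sqrt] is convex, the tangent inequality shows that [P] is the unique
   global minimum, and [s], [t] depend continuously on [P].
   It remains to join two convex configurations. In the coordinates [X = |A_1 A_3|^2] and
   [Y = |A_1 A_4|^2], all convexity conditions except the one on the angle at A_1 define a convex region
   stable under joins, and the angle at A_1 stays below [pi] when [X] and [Y] increase because then
   |A_2 A_5| decreases, again by a positive stress. So each of two convex configurations is joined to
   their join by a segment. *)

(** * Squared distances, orientation and isometries of the plane *)

Definition sqd (p q : point) : R := (fst p - fst q) ^ 2 + (snd p - snd q) ^ 2.

Lemma sqd_ge0 p q : 0 <= sqd p q.
Proof. apply Rplus_le_le_0_compat; apply pow2_ge_0. Qed.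

Lemma sum_sqr_pos x y : x <> 0 \/ y <> 0 -> 0 < x ^ 2 + y ^ 2.
Proof.
  intros [H|H].
  - apply Rplus_lt_le_0_compat; [rewrite <- Rsqr_pow2; now apply Rsqr_pos_lt|apply pow2_ge_0].
  - apply Rplus_le_lt_0_compat; [apply pow2_ge_0|rewrite <- Rsqr_pow2; now apply Rsqr_pos_lt].
Qed.

Lemma sqd_sym p q : sqd p q = sqd q p.
Proof. unfold sqd; ring. Qed.

Lemma dist_sqr p q : dist p q ^ 2 = sqd p q.
Proof.
  change (dist p q) with (sqrt (sqd p q)).
  rewrite <- Rsqr_pow2. apply Rsqr_sqrt, sqd_ge0.
Qed.

Lemma dist_sym p q : dist p q = dist q p.
Proof. change (sqrt (sqd p q) = sqrt (sqd q p)). now rewrite sqd_sym. Qed.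

Lemma dist_eq_iff p q p' q' : dist p q = dist p' q' <-> sqd p q = sqd p' q'.
Proof.
  split; intro H.
  - now rewrite <- !dist_sqr, H.
  - change (sqrt (sqd p q) = sqrt (sqd p' q')). now rewrite H.
Qed.

Lemma cross_rot p q r : cross q r p = cross p q r.
Proof. unfold cross; ring. Qed.

Lemma cross_dist_pos p q r :
  cross p q r <> 0 -> 0 < dist p q /\ 0 < dist p r /\ 0 < dist q r.
Proof.
  assert (K : forall u v w : point, cross u v w <> 0 -> 0 < dist u v).
  { intros u v w H. apply sqrt_lt_R0.
    apply sum_sqr_pos.
    destruct (Req_dec (fst u - fst v) 0) as [h|h]; [|now left].
    destruct (Req_dec (snd u - snd v) 0) as [h'|h']; [|now right].
    exfalso; apply H; unfold cross.
    replace (fst v) with (fst u) by lra; replace (snd v) with (snd u) by lra; ring. }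
  intro H; repeat split.
  - exact (K p q r H).
  - rewrite dist_sym. apply (K r p q). now rewrite <- cross_rot, cross_rot, cross_rot, cross_rot.
  - apply (K q r p). now rewrite cross_rot.
Qed.

(** Counterclockwise convexity, demanded of all triples and not only of those containing an edge, so
    that the signs of the areas entering the stresses can be read off at once. *)
Definition pos_convex (P : config) : Prop :=
  forall i j k, (i < j)%nat -> (j < k)%nat -> (k < 5)%nat ->
    0 < cross (P i) (P j) (P k).

Lemma pos_convex_strictly_convex P : pos_convex P -> strictly_convex P.
Proof.
  intro H; exists 1; split; [now left|]; intros i j Hi Hj Hji Hjn.
  rewrite Rmult_1_l; apply Rlt_gt.
  destruct (Nat.eq_dec i 4) as [->|Hi4].
  - change (nxt 4) with 0%nat in *. rewrite <- cross_rot. apply H; lia.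
  - assert (E : nxt i = S i) by (unfold nxt; rewrite Nat.mod_small; lia).
    rewrite E in *. destruct (Nat.lt_ge_cases j i).
    + rewrite cross_rot. apply H; lia.
    + apply H; lia.
Qed.

(** Among three of five cyclically ordered vertices two are always adjacent, so every triple
    consists of an edge and a third vertex, up to a cyclic rotation. The last case is the edge from
    A_5 to A_1. *)
Lemma strictly_convex_oriented P :
  strictly_convex P ->
  exists eps, (eps = 1 \/ eps = -1) /\
    forall i j k, (i < j)%nat -> (j < k)%nat -> (k < 5)%nat ->
      0 < eps * cross (P i) (P j) (P k).
Proof.
  intros (eps & He & H); exists eps; split; [exact He|]; intros i j k Hij Hjk Hk.
  assert (N : forall m, (m < 4)%nat -> nxt m = S m)
    by (intros; unfold nxt; rewrite Nat.mod_small; lia).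
  destruct (Nat.eq_dec j (S i)) as [->|Hj].
  - rewrite <- (N i) by lia. apply H; rewrite ?N by lia; lia.
  - destruct (Nat.eq_dec k (S j)) as [->|Hk'].
    + rewrite <- cross_rot, <- (N j) by lia. apply H; rewrite ?N by lia; lia.
    + assert (E : i = 0%nat /\ k = 4%nat) by lia. destruct E as [-> ->].
      rewrite <- cross_rot, <- cross_rot. change 0%nat with (nxt 4) at 1.
      apply H; cbv; lia.
Qed.

Lemma congruent_trans P Q S : congruent P Q -> congruent Q S -> congruent P S.
Proof.
  intros (f & Hf & fP) (g & Hg & gQ); exists (fun p => g (f p)); split.
  - intros p q; now rewrite Hg, Hf.
  - intros i Hi; now rewrite fP, gQ.
Qed.

(** A clockwise pentagon is reflected in the horizontal axis, which does not change its class modulo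
    isometries. *)
Lemma in_MC_pos_convex a P :
  in_MC a P -> exists P', in_M a P' /\ pos_convex P' /\ congruent P' P.
Proof.
  intros [HM HC]. destruct (strictly_convex_oriented P HC) as (eps & [->| ->] & H).
  - exists P; repeat split; auto.
    + intros i j k Hi Hj Hk; specialize (H i j k Hi Hj Hk); lra.
    + exists (fun p => p); split; [intros ? ?|]; auto.
  - set (m := fun p : point => (fst p, - snd p)).
    assert (Hm : isometry m)
      by (intros p q; apply dist_eq_iff; unfold sqd, m; simpl; ring).
    exists (fun i => m (P i)); repeat split.
    + intros i Hi; rewrite Hm; auto.
    + intros i j k Hi Hj Hk; specialize (H i j k Hi Hj Hk).
      replace (cross (m (P i)) (m (P j)) (m (P k)))
        with (-1 * cross (P i) (P j) (P k)) by (unfold m, cross; simpl; ring).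
      exact H.
    + exists m; split; [exact Hm|]; intros i _; unfold m; simpl.
      rewrite Ropp_involutive; now destruct (P i).
Qed.

(* Barycentric coordinates with respect to [p], [q], [r] give the affine map onto [p'], [q'], [r']. *)
Lemma triangle_isometry p q r p' q' r' :
  cross p q r <> 0 ->
  sqd p q = sqd p' q' -> sqd p r = sqd p' r' -> sqd q r = sqd q' r' ->
  exists f, isometry f /\ f p = p' /\ f q = q' /\ f r = r' /\
    forall u v w, cross (f u) (f v) (f w) * cross p q r = cross u v w * cross p' q' r'.
Proof.
  destruct p as [px py], q as [qx qy], r as [rx ry],
    p' as [px' py'], q' as [qx' qy'], r' as [rx' ry'].
  unfold cross, sqd; simpl fst; simpl snd; intros Hc H1 H2 H3.
  set (c := (qx - px) * (ry - py) - (qy - py) * (rx - px)) in *.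
  set (al := fun u : point => ((fst u - px) * (ry - py) - (snd u - py) * (rx - px)) / c).
  set (be := fun u : point => ((qx - px) * (snd u - py) - (qy - py) * (fst u - px)) / c).
  exists (fun u => (px' + al u * (qx' - px') + be u * (rx' - px'),
                    py' + al u * (qy' - py') + be u * (ry' - py'))).
  assert (Hd : forall u v, fst u - fst v = (al u - al v) * (qx - px) + (be u - be v) * (rx - px)
     /\ snd u - snd v = (al u - al v) * (qy - py) + (be u - be v) * (ry - py))
    by (intros; unfold al, be, c; split; field; exact Hc).
  repeat split.
  - intros u v. apply dist_eq_iff; unfold sqd; simpl fst; simpl snd.
    destruct (Hd u v) as [-> ->].
    set (x := al u - al v). set (y := be u - be v).
    replace (px' + al u * (qx' - px') + be u * (rx' - px') - (px' + al v * (qx' - px') + be v * (rx' - px')))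
      with (x * (qx' - px') + y * (rx' - px')) by (unfold x, y; ring).
    replace (py' + al u * (qy' - py') + be u * (ry' - py') - (py' + al v * (qy' - py') + be v * (ry' - py')))
      with (x * (qy' - py') + y * (ry' - py')) by (unfold x, y; ring).
    clearbody x y.
    assert (E : (qx - px) * (rx - px) + (qy - py) * (ry - py)
              = (qx' - px') * (rx' - px') + (qy' - py') * (ry' - py')) by lra.
    transitivity (x ^ 2 * ((px' - qx') ^ 2 + (py' - qy') ^ 2)
      + y ^ 2 * ((px' - rx') ^ 2 + (py' - ry') ^ 2)
      + 2 * x * y * ((qx' - px') * (rx' - px') + (qy' - py') * (ry' - py'))); [ring|].
    rewrite <- H1, <- H2, <- E; ring.
  - assert (al (px,py) = 0) as -> by (unfold al; simpl; field; exact Hc).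
    assert (be (px,py) = 0) as -> by (unfold be; simpl; field; exact Hc). f_equal; ring.
  - assert (al (qx,qy) = 1) as -> by (unfold al, c; simpl; field; exact Hc).
    assert (be (qx,qy) = 0) as -> by (unfold be; simpl; field; exact Hc). f_equal; ring.
  - assert (al (rx,ry) = 0) as -> by (unfold al; simpl; field; exact Hc).
    assert (be (rx,ry) = 1) as -> by (unfold be, c; simpl; field; exact Hc). f_equal; ring.
  - intros u v w; simpl fst; simpl snd.
    destruct (Hd v u) as [-> ->]. destruct (Hd w u) as [-> ->].
    unfold c; ring.
Qed.

(** Subtracting the equations in pairs shows that [u - v] is orthogonal to the linearly independent
    vectors [q - p] and [r - p]. *)
Lemma point_eq_of_sqd3 p q r u v :
  cross p q r <> 0 ->
  sqd p u = sqd p v -> sqd q u = sqd q v -> sqd r u = sqd r v -> u = v.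
Proof.
  destruct p as [px py], q as [qx qy], r as [rx ry], u as [ux uy], v as [vx vy].
  unfold cross, sqd; simpl; intros Hc H1 H2 H3.
  set (c := (qx - px) * (ry - py) - (qy - py) * (rx - px)) in *.
  assert (A : (qx - px) * (ux - vx) + (qy - py) * (uy - vy) = 0) by lra.
  assert (B : (rx - px) * (ux - vx) + (ry - py) * (uy - vy) = 0) by lra.
  assert (C1 : c * (ux - vx) = 0).
  { replace (c * (ux - vx)) with ((ry - py) * ((qx - px) * (ux - vx) + (qy - py) * (uy - vy))
      - (qy - py) * ((rx - px) * (ux - vx) + (ry - py) * (uy - vy))) by (unfold c; ring).
    rewrite A, B; ring. }
  assert (C2 : c * (uy - vy) = 0).
  { replace (c * (uy - vy)) with ((qx - px) * ((rx - px) * (ux - vx) + (ry - py) * (uy - vy))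
      - (rx - px) * ((qx - px) * (ux - vx) + (qy - py) * (uy - vy))) by (unfold c; ring).
    rewrite A, B; ring. }
  apply Rmult_integral in C1; apply Rmult_integral in C2.
  f_equal; lra.
Qed.

(** Heron's formula determines the cross product up to sign and the side fixes the sign. Then
    [u - v] has zero inner product and zero cross product with [q - p]. *)
Lemma point_eq_of_side p q u v :
  sqd p u = sqd p v -> sqd q u = sqd q v ->
  0 < cross p q u * cross p q v -> u = v.
Proof.
  intros H1 H2 Hs.
  assert (Hc : cross p q u <> 0) by (intro E; rewrite E in Hs; lra).
  assert (E : cross p q u = cross p q v).
  { assert (S : cross p q u ^ 2 = cross p q v ^ 2).
    { assert (G : forall w, 4 * cross p q w ^ 2
        = 4 * sqd p q * sqd p w - (sqd p q + sqd p w - sqd q w) ^ 2)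
        by (intro; unfold cross, sqd; ring).
      pose proof (G u); pose proof (G v). rewrite H1, H2 in *. lra. }
    assert ((cross p q u - cross p q v) * (cross p q u + cross p q v) = 0) by lra.
    apply Rmult_integral in H; destruct H; nra. }
  destruct p as [px py], q as [qx qy], u as [ux uy], v as [vx vy].
  unfold cross, sqd in *; simpl in *.
  assert (D : 0 < (qx - px) ^ 2 + (qy - py) ^ 2).
  { apply sum_sqr_pos.
    destruct (Req_dec (qx - px) 0) as [h|h]; [|now left].
    right; intro h'; apply Hc; rewrite h, h'; ring. }
  assert (A : (qx - px) * (ux - vx) + (qy - py) * (uy - vy) = 0) by lra.
  assert (B : (qx - px) * (uy - vy) - (qy - py) * (ux - vx) = 0) by lra.
  assert (C1 : ((qx - px) ^ 2 + (qy - py) ^ 2) * (ux - vx) = 0).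
  { transitivity ((qx - px) * ((qx - px) * (ux - vx) + (qy - py) * (uy - vy))
      - (qy - py) * ((qx - px) * (uy - vy) - (qy - py) * (ux - vx))); [ring|rewrite A, B; ring]. }
  assert (C2 : ((qx - px) ^ 2 + (qy - py) ^ 2) * (uy - vy) = 0).
  { transitivity ((qy - py) * ((qx - px) * (ux - vx) + (qy - py) * (uy - vy))
      + (qx - px) * ((qx - px) * (uy - vy) - (qy - py) * (ux - vx))); [ring|rewrite A, B; ring]. }
  apply Rmult_integral in C1; apply Rmult_integral in C2.
  f_equal; lra.
Qed.

(** * Equilibrium stresses and the stabilizing charges *)

Lemma heron_cross p q r :
  4 * cross p q r ^ 2 = 4 * sqd p q * sqd p r - (sqd p q + sqd p r - sqd q r) ^ 2.
Proof. unfold cross, sqd; ring. Qed.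

(** The isometry is fixed by the nondegenerate triangle A_1 A_3 A_4; the other vertices follow
    because three noncollinear distances determine a point. *)
Lemma congruent_of_sqd P Q :
  cross (P 0%nat) (P 2%nat) (P 3%nat) <> 0 ->
  (forall i j, (i < 5)%nat -> (j < 5)%nat -> sqd (P i) (P j) = sqd (Q i) (Q j)) ->
  congruent P Q.
Proof.
  intros Hc H.
  destruct (triangle_isometry _ _ _ (Q 0%nat) (Q 2%nat) (Q 3%nat) Hc)
    as (f & Hf & f0 & f2 & f3 & _); try (apply H; lia).
  assert (HcQ : cross (Q 0%nat) (Q 2%nat) (Q 3%nat) <> 0).
  { intro E. pose proof (heron_cross (P 0%nat) (P 2%nat) (P 3%nat)) as h.
    rewrite !H, <- heron_cross, E in h by lia.
    apply Hc. apply Rsqr_0_uniq. rewrite Rsqr_pow2. lra. }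
  exists f; split; [exact Hf|]; intros i Hi.
  assert (S : forall u v, sqd (f u) (f v) = sqd u v)
    by (intros; apply dist_eq_iff, Hf).
  apply (point_eq_of_sqd3 _ _ _ _ _ HcQ);
    [rewrite <- f0 at 1|rewrite <- f2 at 1|rewrite <- f3 at 1]; rewrite S; apply H; lia.
Qed.

Lemma weighted_squares b0 b1 b2 b3 b4 x0 x1 x2 x3 x4 :
  b0 + b1 + b2 + b3 + b4 = 0 ->
  b0 * b1 * (x0 - x1) ^ 2 + b1 * b2 * (x1 - x2) ^ 2 + b2 * b3 * (x2 - x3) ^ 2
  + b3 * b4 * (x3 - x4) ^ 2 + b4 * b0 * (x4 - x0) ^ 2
  + b0 * b2 * (x0 - x2) ^ 2 + b0 * b3 * (x0 - x3) ^ 2 + b1 * b3 * (x1 - x3) ^ 2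
  + b1 * b4 * (x1 - x4) ^ 2 + b2 * b4 * (x2 - x4) ^ 2
  = - (b0 * x0 + b1 * x1 + b2 * x2 + b3 * x3 + b4 * x4) ^ 2.
Proof.
  intro H; replace b4 with (- (b0 + b1 + b2 + b3)) by lra; ring.
Qed.

(** An affine dependency of the vertices. The products [b_i b_j] then form a rank-one equilibrium
    stress: the forces [b_i b_j (P_j - P_i)] sum to zero at each vertex. *)
Definition dependency (P : config) (b0 b1 b2 b3 b4 : R) : Prop :=
  b0 + b1 + b2 + b3 + b4 = 0 /\
  b0 * fst (P 0%nat) + b1 * fst (P 1%nat) + b2 * fst (P 2%nat)
    + b3 * fst (P 3%nat) + b4 * fst (P 4%nat) = 0 /\
  b0 * snd (P 0%nat) + b1 * snd (P 1%nat) + b2 * snd (P 2%nat)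
    + b3 * snd (P 3%nat) + b4 * snd (P 4%nat) = 0.

Definition diag_incr (P Q : config) (i j : nat) : R :=
  sqd (Q i) (Q j) - sqd (P i) (P j).

Lemma dependency_diag_incr a P Q b0 b1 b2 b3 b4 :
  in_M a P -> in_M a Q -> dependency P b0 b1 b2 b3 b4 ->
  b0 * b2 * diag_incr P Q 0 2 + b0 * b3 * diag_incr P Q 0 3
  + b1 * b3 * diag_incr P Q 1 3 + b1 * b4 * diag_incr P Q 1 4
  + b2 * b4 * diag_incr P Q 2 4 <= 0.
Proof.
  intros HP HQ (S & Sx & Sy).
  assert (E : forall i, (i < 5)%nat -> sqd (Q i) (Q (nxt i)) = sqd (P i) (P (nxt i)))
    by (intros i Hi; apply dist_eq_iff; now rewrite HP, HQ).
  pose proof (E 0%nat ltac:(lia)) as E0. pose proof (E 1%nat ltac:(lia)) as E1.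
  pose proof (E 2%nat ltac:(lia)) as E2. pose proof (E 3%nat ltac:(lia)) as E3.
  pose proof (E 4%nat ltac:(lia)) as E4. clear E.
  change (nxt 0) with 1%nat in *. change (nxt 1) with 2%nat in *.
  change (nxt 2) with 3%nat in *. change (nxt 3) with 4%nat in *.
  change (nxt 4) with 0%nat in *.
  assert (W : forall C : config,
    b0 * b1 * sqd (C 0%nat) (C 1%nat) + b1 * b2 * sqd (C 1%nat) (C 2%nat)
    + b2 * b3 * sqd (C 2%nat) (C 3%nat) + b3 * b4 * sqd (C 3%nat) (C 4%nat)
    + b4 * b0 * sqd (C 4%nat) (C 0%nat) + b0 * b2 * sqd (C 0%nat) (C 2%nat)
    + b0 * b3 * sqd (C 0%nat) (C 3%nat) + b1 * b3 * sqd (C 1%nat) (C 3%nat)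
    + b1 * b4 * sqd (C 1%nat) (C 4%nat) + b2 * b4 * sqd (C 2%nat) (C 4%nat)
    = - (b0 * fst (C 0%nat) + b1 * fst (C 1%nat) + b2 * fst (C 2%nat)
         + b3 * fst (C 3%nat) + b4 * fst (C 4%nat)) ^ 2
      - (b0 * snd (C 0%nat) + b1 * snd (C 1%nat) + b2 * snd (C 2%nat)
         + b3 * snd (C 3%nat) + b4 * snd (C 4%nat)) ^ 2).
  { intro C.
    pose proof (weighted_squares _ _ _ _ _ (fst (C 0%nat)) (fst (C 1%nat))
      (fst (C 2%nat)) (fst (C 3%nat)) (fst (C 4%nat)) S) as Wx.
    pose proof (weighted_squares _ _ _ _ _ (snd (C 0%nat)) (snd (C 1%nat))
      (snd (C 2%nat)) (snd (C 3%nat)) (snd (C 4%nat)) S) as Wy.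
    unfold sqd; lra. }
  pose proof (W P) as WP. pose proof (W Q) as WQ. rewrite Sx, Sy in WP.
  rewrite E0, E1, E2, E3, E4 in WQ.
  pose proof (pow2_ge_0 (b0 * fst (Q 0%nat) + b1 * fst (Q 1%nat) + b2 * fst (Q 2%nat)
    + b3 * fst (Q 3%nat) + b4 * fst (Q 4%nat))).
  pose proof (pow2_ge_0 (b0 * snd (Q 0%nat) + b1 * snd (Q 1%nat) + b2 * snd (Q 2%nat)
    + b3 * snd (Q 3%nat) + b4 * snd (Q 4%nat))).
  unfold diag_incr; lra.
Qed.

Definition area (P : config) (i j k : nat) : R := cross (P i) (P j) (P k).

(* The affine dependency of the four vertices other than [P 3]. *)
Lemma dependency_nu P :
  dependency P (area P 1 2 4) (- area P 0 2 4) (area P 0 1 4) 0 (- area P 0 1 2).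
Proof. unfold dependency, area, cross; repeat split; ring. Qed.

(** Cramer's rule: the entries at A_1 and A_2 are prescribed, and the remaining three are found by
    applying to the dependency the affine functions that vanish on the sides of the triangle A_3 A_4
    A_5. *)
Definition beta2 (P : config) b0 b1 :=
  - (b0 * area P 0 3 4 + b1 * area P 1 3 4) / area P 2 3 4.
Definition beta3 (P : config) b0 b1 :=
  (b0 * area P 0 2 4 + b1 * area P 1 2 4) / area P 2 3 4.
Definition beta4 (P : config) b0 b1 :=
  - (b0 * area P 0 2 3 + b1 * area P 1 2 3) / area P 2 3 4.

Lemma dependency_beta P b0 b1 :
  area P 2 3 4 <> 0 ->
  dependency P b0 b1 (beta2 P b0 b1) (beta3 P b0 b1) (beta4 P b0 b1).
Proof.
  unfold dependency, beta2, beta3, beta4, area, cross; intro H; repeat split; field; exact H.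
Qed.

Definition quad_root A B C := (- B + sqrt (B ^ 2 - 4 * A * C)) / (2 * A).

(** A point where an upward parabola is negative lies strictly between two real roots. Hence [v]
    certifies the positive discriminant and bounds the larger root from below. *)
Lemma quad_root_spec A B C v :
  0 < A -> A * v ^ 2 + B * v + C < 0 ->
  0 < B ^ 2 - 4 * A * C /\ v < quad_root A B C /\
  A * quad_root A B C ^ 2 + B * quad_root A B C + C = 0.
Proof.
  intros HA Hv.
  assert (HD : (2 * A * v + B) ^ 2 < B ^ 2 - 4 * A * C).
  { replace ((2 * A * v + B) ^ 2) with (B ^ 2 - 4 * A * C + 4 * A * (A * v ^ 2 + B * v + C)) by ring.
    assert (0 < 4 * A * - (A * v ^ 2 + B * v + C)) by (apply Rmult_lt_0_compat; lra). lra. }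
  pose proof (pow2_ge_0 (2 * A * v + B)) as H0.
  assert (HDp : 0 < B ^ 2 - 4 * A * C) by lra.
  unfold quad_root. set (D := B ^ 2 - 4 * A * C) in *.
  assert (Hs : sqrt D ^ 2 = D) by (rewrite <- Rsqr_pow2; apply Rsqr_sqrt; lra).
  repeat split; [exact HDp| |].
  - assert (2 * A * v + B < sqrt D).
    { apply Rle_lt_trans with (1 := Rle_abs _). rewrite <- sqrt_Rsqr_abs.
      apply sqrt_lt_1; rewrite ?Rsqr_pow2; lra. }
    apply (Rmult_lt_reg_l (2 * A)); [lra|].
    replace (2 * A * ((- B + sqrt D) / (2 * A))) with (- B + sqrt D) by (field; lra). lra.
  - replace (A * ((- B + sqrt D) / (2 * A)) ^ 2 + B * ((- B + sqrt D) / (2 * A)) + C)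
      with ((sqrt D ^ 2 - (B ^ 2 - 4 * A * C)) / (4 * A)) by (field; lra).
    rewrite Hs. unfold D; field; lra.
Qed.

(** The tangent at [d0 ^ 2] of the potential as a convex function of the squared distance. The gap
    is a positive multiple of [(d - d0) ^ 2], which also settles the equality case. *)
Lemma coulomb_tangent c d0 d :
  0 < c -> 0 < d0 -> 0 < d ->
  c / d0 <= c / d + c / d0 ^ 3 / 2 * (d ^ 2 - d0 ^ 2) /\
  (c / d + c / d0 ^ 3 / 2 * (d ^ 2 - d0 ^ 2) <= c / d0 -> d = d0).
Proof.
  intros Hc H0 H.
  assert (E : c / d + c / d0 ^ 3 / 2 * (d ^ 2 - d0 ^ 2) - c / d0
    = (c * (2 * d0 + d) / (2 * d * d0 ^ 3)) * (d - d0) ^ 2) by (field; lra).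
  assert (K : 0 < c * (2 * d0 + d) / (2 * d * d0 ^ 3)).
  { apply Rdiv_lt_0_compat; repeat apply Rmult_lt_0_compat; try apply pow_lt; lra. }
  pose proof (pow2_ge_0 (d - d0)) as Hsq.
  split.
  - assert (0 <= (c * (2 * d0 + d) / (2 * d * d0 ^ 3)) * (d - d0) ^ 2)
      by (apply Rmult_le_pos; lra). lra.
  - intro Hle. destruct (Rle_lt_or_eq_dec _ _ Hsq) as [h|h].
    + assert (0 < (c * (2 * d0 + d) / (2 * d * d0 ^ 3)) * (d - d0) ^ 2)
        by (apply Rmult_lt_0_compat; lra). lra.
    + symmetry in h. rewrite <- Rsqr_pow2 in h. apply Rsqr_0_uniq in h. lra.
Qed.

(** Half of the assumed sum is the total linear correction in the five tangent inequalities. If the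
    energy of [Q] does not exceed that of [P], all five are equalities, so [P] and [Q] have the same
    diagonals as well as the same sides. *)
Lemma unique_global_min_of_stress a P q1 q2 q4 s t :
  in_M a P -> cross (P 0%nat) (P 2%nat) (P 3%nat) <> 0 -> admissible P ->
  0 < q1 -> 0 < q2 -> 0 < q4 -> 0 < s -> 0 < t ->
  (forall Q, in_M a Q ->
    q1 * q4 / dist (P 0%nat) (P 3%nat) ^ 3 * diag_incr P Q 0 3
    + q2 * q4 / dist (P 1%nat) (P 3%nat) ^ 3 * diag_incr P Q 1 3
    + q1 * t / dist (P 0%nat) (P 2%nat) ^ 3 * diag_incr P Q 0 2
    + q2 * s / dist (P 1%nat) (P 4%nat) ^ 3 * diag_incr P Q 1 4
    + s * t / dist (P 2%nat) (P 4%nat) ^ 3 * diag_incr P Q 2 4 <= 0) ->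
  unique_global_min a q1 q2 q4 s t P.
Proof.
  intros HM Hc HA Hq1 Hq2 Hq4 Hs Ht H.
  split; [exact HM|split; [exact HA|]]; intros Q HQ HAQ Hn.
  specialize (H Q HQ).
  apply Rnot_le_lt; intro Hle; apply Hn; clear Hn.
  destruct HA as (A03 & A13 & A02 & A14 & A24).
  destruct HAQ as (B03 & B13 & B02 & B14 & B24).
  unfold energy in Hle. unfold diag_incr in H. rewrite <- !dist_sqr in H.
  assert (M : forall x y, 0 < x -> 0 < y -> 0 < x * y) by apply Rmult_lt_0_compat.
  destruct (coulomb_tangent (q1 * q4) _ _ (M _ _ Hq1 Hq4) A03 B03) as [T03 U03].
  destruct (coulomb_tangent (q2 * q4) _ _ (M _ _ Hq2 Hq4) A13 B13) as [T13 U13].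
  destruct (coulomb_tangent (q1 * t) _ _ (M _ _ Hq1 Ht) A02 B02) as [T02 U02].
  destruct (coulomb_tangent (q2 * s) _ _ (M _ _ Hq2 Hs) A14 B14) as [T14 U14].
  destruct (coulomb_tangent (s * t) _ _ (M _ _ Hs Ht) A24 B24) as [T24 U24].
  assert (E03 := U03 ltac:(lra)). assert (E13 := U13 ltac:(lra)).
  assert (E02 := U02 ltac:(lra)). assert (E14 := U14 ltac:(lra)).
  assert (E24 := U24 ltac:(lra)).
  apply congruent_of_sqd; [exact Hc|]; intros i j Hi Hj; apply dist_eq_iff.
  assert (Sd : forall i, (i < 5)%nat -> dist (P i) (P (nxt i)) = dist (Q i) (Q (nxt i)))
    by (intros; now rewrite HM, HQ).
  pose proof (Sd 0%nat ltac:(lia)) as S0. pose proof (Sd 1%nat ltac:(lia)) as S1.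
  pose proof (Sd 2%nat ltac:(lia)) as S2. pose proof (Sd 3%nat ltac:(lia)) as S3.
  pose proof (Sd 4%nat ltac:(lia)) as S4.
  change (nxt 0) with 1%nat in *. change (nxt 1) with 2%nat in *.
  change (nxt 2) with 3%nat in *. change (nxt 3) with 4%nat in *.
  change (nxt 4) with 0%nat in *.
  assert (R0 : forall p, dist p p = 0) by
    (intro p; change (sqrt (sqd p p) = 0); replace (sqd p p) with 0 by (unfold sqd; ring); apply sqrt_0).
  assert (Ci : (i = 0 \/ i = 1 \/ i = 2 \/ i = 3 \/ i = 4)%nat) by lia.
  assert (Cj : (j = 0 \/ j = 1 \/ j = 2 \/ j = 3 \/ j = 4)%nat) by lia.
  destruct Ci as [->|[->|[->|[->| ->]]]], Cj as [->|[->|[->|[->| ->]]]];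
    rewrite ?R0; try reflexivity; try congruence;
    rewrite (dist_sym (P _)), (dist_sym (Q _)); congruence.
Qed.

(** * The multiplier lambda and the stabilizing charges *)

Definition lambda_B b d f k p p' := f - k * (b * p' + d * p).
Definition lambda_root b d f k p p' e :=
  quad_root (k * b * d) (lambda_B b d f k p p') (k * p * p' - e).

(** The equation is [k (b l - p) (d l - p') = e - f l], with [l] the larger root. At [p / b] and at
    [p' / d] the product vanishes and the quadratic has the value [f l - e], negative by hypothesis,
    so the larger root exceeds both points. *)
Lemma lambda_root_spec b d f k p p' e :
  0 < b -> 0 < d -> 0 < k -> f * p < e * b -> f * p' < e * d ->
  0 < lambda_B b d f k p p' ^ 2 - 4 * (k * b * d) * (k * p * p' - e) /\
  0 < b * lambda_root b d f k p p' e - p /\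
  0 < d * lambda_root b d f k p p' e - p' /\
  k * (b * lambda_root b d f k p p' e - p) * (d * lambda_root b d f k p p' e - p')
  = e - f * lambda_root b d f k p p' e.
Proof.
  intros Hb Hd Hk Hp Hp'.
  assert (HA : 0 < k * b * d) by (repeat apply Rmult_lt_0_compat; assumption).
  assert (V : forall c x, 0 < c -> f * x < e * c -> f * (x / c) - e < 0).
  { intros c x Hc Hx. apply (Rmult_lt_reg_l c); [exact Hc|].
    replace (c * (f * (x / c) - e)) with (f * x - e * c) by (field; lra). lra. }
  unfold lambda_root, lambda_B.
  set (B := f - k * (b * p' + d * p)). set (C := k * p * p' - e).
  destruct (quad_root_spec (k * b * d) B C (p / b) HA) as (D & L & E).
  { replace (k * b * d * (p / b) ^ 2 + B * (p / b) + C) with (f * (p / b) - e)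
      by (unfold B, C; field; lra). now apply V. }
  destruct (quad_root_spec (k * b * d) B C (p' / d) HA) as (_ & L' & _).
  { replace (k * b * d * (p' / d) ^ 2 + B * (p' / d) + C) with (f * (p' / d) - e)
      by (unfold B, C; field; lra). now apply V. }
  set (r := quad_root (k * b * d) B C) in *.
  assert (G : forall c x, 0 < c -> x / c < r -> 0 < c * r - x).
  { intros c x Hc Hx. apply (Rmult_lt_compat_l c) in Hx; [|exact Hc].
    replace (c * (x / c)) with x in Hx by (field; lra). lra. }
  repeat split; auto.
  unfold B, C in E. lra.
Qed.

(* [stress_lambda] makes the stress [beta_i beta_j / beta3 + lambda nu_i nu_j] of the diagonal 35
   equal to the Coulomb stress of the charges [s] and [t] read off from the diagonals 25 and 13. *)
Definition coulomb_stress q q' (P : config) i j := q * q' / dist (P i) (P j) ^ 3.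

(** The combined stress is affine in [l]: [stress_b * l - stress_p] on 13,
    [stress_d * l - stress_p'] on 25 and [stress_e - stress_f * l] on 35. On 14 and 24 it is [b0]
    and [b1] whatever [l] is, as nu vanishes at A_4. The factor [stress_k] turns the product of the
    Coulomb stresses on 13 and 25 into the one on 35. *)
Definition stress_b P := area P 1 2 4 * area P 0 1 4.
Definition stress_d P := area P 0 2 4 * area P 0 1 2.
Definition stress_f P := area P 0 1 4 * area P 0 1 2.
Definition stress_k q1 q2 (P : config) :=
  dist (P 0%nat) (P 2%nat) ^ 3 * dist (P 1%nat) (P 4%nat) ^ 3
  / (q1 * q2 * dist (P 2%nat) (P 4%nat) ^ 3).
Definition stress_p P b0 b1 := - (b0 * beta2 P b0 b1) / beta3 P b0 b1.
Definition stress_p' P b0 b1 := - (b1 * beta4 P b0 b1) / beta3 P b0 b1.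
Definition stress_e P b0 b1 := beta2 P b0 b1 * beta4 P b0 b1 / beta3 P b0 b1.

Definition stress_lambda q1 q2 P b0 b1 :=
  lambda_root (stress_b P) (stress_d P) (stress_f P) (stress_k q1 q2 P)
    (stress_p P b0 b1) (stress_p' P b0 b1) (stress_e P b0 b1).

Definition charge_t q1 q2 q4 (P : config) :=
  let b0 := coulomb_stress q1 q4 P 0 3 in
  let b1 := coulomb_stress q2 q4 P 1 3 in
  dist (P 0%nat) (P 2%nat) ^ 3
    * (stress_b P * stress_lambda q1 q2 P b0 b1 - stress_p P b0 b1) / q1.

Definition charge_s q1 q2 q4 (P : config) :=
  let b0 := coulomb_stress q1 q4 P 0 3 in
  let b1 := coulomb_stress q2 q4 P 1 3 in
  dist (P 1%nat) (P 4%nat) ^ 3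
    * (stress_d P * stress_lambda q1 q2 P b0 b1 - stress_p' P b0 b1) / q2.

Lemma pos_convex_dist P i j :
  pos_convex P -> (i < j)%nat -> (j < 5)%nat -> 0 < dist (P i) (P j).
Proof.
  intros H Hij Hj.
  destruct (Nat.eq_dec j 4) as [->|h].
  - destruct (Nat.eq_dec i 0) as [->|h'].
    + apply (cross_dist_pos (P 0%nat) (P 1%nat) (P 4%nat)).
      apply Rgt_not_eq, H; lia.
    + apply (cross_dist_pos (P 0%nat) (P i) (P 4%nat)).
      apply Rgt_not_eq, H; lia.
  - apply (cross_dist_pos (P i) (P j) (P 4%nat)).
    apply Rgt_not_eq, H; lia.
Qed.

Lemma pos_convex_admissible P : pos_convex P -> admissible P.
Proof. intro H; repeat split; apply pos_convex_dist; auto; lia. Qed.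

Lemma stress_signs P b0 b1 :
  pos_convex P -> 0 < b0 -> 0 < b1 ->
  beta2 P b0 b1 < 0 /\ 0 < beta3 P b0 b1 /\ beta4 P b0 b1 < 0.
Proof.
  intros H H0 H1.
  assert (Pp : forall i j k, (i < j)%nat -> (j < k)%nat -> (k < 5)%nat -> 0 < area P i j k)
    by exact H.
  assert (X : forall x y z, 0 < x -> 0 < y -> 0 < z -> 0 < (b0 * x + b1 * y) / z).
  { intros. apply Rdiv_lt_0_compat; [|assumption].
    apply Rplus_lt_0_compat; apply Rmult_lt_0_compat; assumption. }
  unfold beta2, beta3, beta4; rewrite !Rdiv_opp_l.
  assert (Y2 := X _ _ _ (Pp 0 3 4 ltac:(lia) ltac:(lia) ltac:(lia))%nat
    (Pp 1 3 4 ltac:(lia) ltac:(lia) ltac:(lia))%nat (Pp 2 3 4 ltac:(lia) ltac:(lia) ltac:(lia))%nat).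
  assert (Y4 := X _ _ _ (Pp 0 2 3 ltac:(lia) ltac:(lia) ltac:(lia))%nat
    (Pp 1 2 3 ltac:(lia) ltac:(lia) ltac:(lia))%nat (Pp 2 3 4 ltac:(lia) ltac:(lia) ltac:(lia))%nat).
  repeat split; try lra. apply X; apply Pp; lia.
Qed.

(** Both hypotheses of [lambda_root_spec] reduce to products of positive areas. The leading
    coefficient and the discriminant are recorded as positive for the sake of continuity of the root
    in [P]. *)
Lemma stress_lambda_spec q1 q2 P b0 b1 :
  pos_convex P -> 0 < q1 -> 0 < q2 -> 0 < b0 -> 0 < b1 ->
  let l := stress_lambda q1 q2 P b0 b1 in
  0 < stress_k q1 q2 P * stress_b P * stress_d P /\
  0 < lambda_B (stress_b P) (stress_d P) (stress_f P) (stress_k q1 q2 P)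
        (stress_p P b0 b1) (stress_p' P b0 b1) ^ 2
      - 4 * (stress_k q1 q2 P * stress_b P * stress_d P)
        * (stress_k q1 q2 P * stress_p P b0 b1 * stress_p' P b0 b1 - stress_e P b0 b1) /\
  0 < l /\
  0 < stress_b P * l - stress_p P b0 b1 /\
  0 < stress_d P * l - stress_p' P b0 b1 /\
  stress_k q1 q2 P * (stress_b P * l - stress_p P b0 b1)
    * (stress_d P * l - stress_p' P b0 b1) = stress_e P b0 b1 - stress_f P * l.
Proof.
  intros H Hq1 Hq2 H0 H1.
  assert (Pp : forall i j k, (i < j)%nat -> (j < k)%nat -> (k < 5)%nat -> 0 < area P i j k)
    by exact H.
  assert (M : forall x y, 0 < x -> 0 < y -> 0 < x * y) by apply Rmult_lt_0_compat.
  assert (Hd : forall i j, (i < j)%nat -> (j < 5)%nat -> 0 < dist (P i) (P j))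
    by (intros; now apply pos_convex_dist).
  assert (Hb : 0 < stress_b P) by (apply M; apply Pp; lia).
  assert (Hdd : 0 < stress_d P) by (apply M; apply Pp; lia).
  assert (Hk : 0 < stress_k q1 q2 P).
  { apply Rdiv_lt_0_compat; [|apply M; [now apply M|]]; [apply M|]; apply pow_lt, Hd; lia. }
  destruct (stress_signs P b0 b1 H H0 H1) as (S2 & S3 & S4).
  assert (Hp : 0 < stress_p P b0 b1).
  { unfold stress_p. apply Rdiv_lt_0_compat; [|exact S3].
    rewrite <- Ropp_mult_distr_r_reverse. apply M; lra. }
  pose proof (Pp 2 3 4 ltac:(lia) ltac:(lia) ltac:(lia))%nat as A234.
  destruct (lambda_root_spec (stress_b P) (stress_d P) (stress_f P) (stress_k q1 q2 P)
    (stress_p P b0 b1) (stress_p' P b0 b1) (stress_e P b0 b1) Hb Hdd Hk) as (D & L & L' & E).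
  - enough (0 < stress_e P b0 b1 * stress_b P - stress_f P * stress_p P b0 b1) by lra.
    replace (stress_e P b0 b1 * stress_b P - stress_f P * stress_p P b0 b1)
      with (- beta2 P b0 b1 / beta3 P b0 b1 * area P 0 1 4 *
        (- beta4 P b0 b1 * area P 1 2 4 - area P 0 1 2 * b0))
      by (unfold stress_e, stress_b, stress_f, stress_p; field; lra).
    apply M; [apply M; [apply Rdiv_lt_0_compat; lra|apply Pp; lia]|].
    (* The negative term is absorbed by the Plücker relation [area P 0 2 3 * area P 1 2 4 - area P 0
       1 2 * area P 2 3 4 = area P 0 2 4 * area P 1 2 3]. *)
    replace (- beta4 P b0 b1 * area P 1 2 4 - area P 0 1 2 * b0)
      with ((area P 1 2 3 * area P 1 2 4 * b1 + area P 0 2 4 * area P 1 2 3 * b0) / area P 2 3 4).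
    2:{ unfold beta4. apply (Rmult_eq_reg_r (area P 2 3 4)); [|lra].
        field_simplify; [|lra|lra]. unfold area, cross; ring. }
    apply Rdiv_lt_0_compat; [|exact A234].
    apply Rplus_lt_0_compat; repeat apply M; auto; apply Pp; lia.
  - enough (0 < stress_e P b0 b1 * stress_d P - stress_f P * stress_p' P b0 b1) by lra.
    replace (stress_e P b0 b1 * stress_d P - stress_f P * stress_p' P b0 b1)
      with (- beta4 P b0 b1 / beta3 P b0 b1 * area P 0 1 2 *
        (- beta2 P b0 b1 * area P 0 2 4 - area P 0 1 4 * b1))
      by (unfold stress_e, stress_d, stress_f, stress_p'; field; lra).
    apply M; [apply M; [apply Rdiv_lt_0_compat; lra|apply Pp; lia]|].
    (* Here the relation is [area P 1 3 4 * area P 0 2 4 - area P 0 1 4 * area P 2 3 4 = area P 0 3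
       4 * area P 1 2 4]. *)
    replace (- beta2 P b0 b1 * area P 0 2 4 - area P 0 1 4 * b1)
      with ((area P 0 3 4 * area P 0 2 4 * b0 + area P 0 3 4 * area P 1 2 4 * b1) / area P 2 3 4).
    2:{ unfold beta2. apply (Rmult_eq_reg_r (area P 2 3 4)); [|lra].
        field_simplify; [|lra|lra]. unfold area, cross; ring. }
    apply Rdiv_lt_0_compat; [|exact A234].
    apply Rplus_lt_0_compat; repeat apply M; auto; apply Pp; lia.
  - fold (stress_lambda q1 q2 P b0 b1) in L, L', E.
    cbv zeta; repeat split; auto.
    apply (Rmult_lt_reg_l (stress_b P)); [exact Hb|]. lra.
Qed.

Lemma charges_stabilize a P q1 q2 q4 :
  in_M a P -> pos_convex P -> 0 < q1 -> 0 < q2 -> 0 < q4 ->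
  0 < charge_s q1 q2 q4 P /\ 0 < charge_t q1 q2 q4 P /\
  unique_global_min a q1 q2 q4 (charge_s q1 q2 q4 P) (charge_t q1 q2 q4 P) P.
Proof.
  intros HM H Hq1 Hq2 Hq4.
  assert (M : forall x y, 0 < x -> 0 < y -> 0 < x * y) by apply Rmult_lt_0_compat.
  assert (Hd : forall i j, (i < j)%nat -> (j < 5)%nat -> 0 < dist (P i) (P j))
    by (intros; now apply pos_convex_dist).
  set (s := charge_s q1 q2 q4 P). set (t := charge_t q1 q2 q4 P).
  assert (H0 : 0 < coulomb_stress q1 q4 P 0 3).
  { apply Rdiv_lt_0_compat; [now apply M|apply pow_lt, Hd; lia]. }
  assert (H1 : 0 < coulomb_stress q2 q4 P 1 3).
  { apply Rdiv_lt_0_compat; [now apply M|apply pow_lt, Hd; lia]. }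
  set (b0 := coulomb_stress q1 q4 P 0 3) in *.
  set (b1 := coulomb_stress q2 q4 P 1 3) in *.
  destruct (stress_lambda_spec q1 q2 P b0 b1 H Hq1 Hq2 H0 H1) as (_ & _ & L0 & L & L' & E).
  destruct (stress_signs P b0 b1 H H0 H1) as (_ & S3 & _).
  assert (D02 := Hd 0%nat 2%nat ltac:(lia) ltac:(lia)).
  assert (D14 := Hd 1%nat 4%nat ltac:(lia) ltac:(lia)).
  assert (D24 := Hd 2%nat 4%nat ltac:(lia) ltac:(lia)).
  assert (Hs : 0 < s).
  { apply Rdiv_lt_0_compat; [|exact Hq2]. apply M; [now apply pow_lt|exact L']. }
  assert (Ht : 0 < t).
  { apply Rdiv_lt_0_compat; [|exact Hq1]. apply M; [now apply pow_lt|exact L]. }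
  repeat split; auto; [now apply pos_convex_admissible..|].
  apply unique_global_min_of_stress; auto.
  - apply Rgt_not_eq, H; lia.
  - now apply pos_convex_admissible.
  - intros Q HQ.
    fold (coulomb_stress q1 q4 P 0 3) (coulomb_stress q2 q4 P 1 3); fold b0 b1.
    assert (A234 : area P 2 3 4 <> 0) by (apply Rgt_not_eq, H; lia).
    pose proof (dependency_diag_incr a P Q _ _ _ _ _ HM HQ (dependency_beta P b0 b1 A234)) as Ib.
    pose proof (dependency_diag_incr a P Q _ _ _ _ _ HM HQ (dependency_nu P)) as In.
    set (l := stress_lambda q1 q2 P b0 b1) in *.
    assert (E02 : q1 * t / dist (P 0%nat) (P 2%nat) ^ 3
      = b0 * beta2 P b0 b1 / beta3 P b0 b1 + l * (area P 1 2 4 * area P 0 1 4)).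
    { replace (q1 * t / dist (P 0%nat) (P 2%nat) ^ 3) with (stress_b P * l - stress_p P b0 b1)
        by (unfold t, charge_t; fold b0 b1 l; field; lra).
      unfold stress_p, stress_b; field; lra. }
    assert (E14 : q2 * s / dist (P 1%nat) (P 4%nat) ^ 3
      = b1 * beta4 P b0 b1 / beta3 P b0 b1 + l * (area P 0 2 4 * area P 0 1 2)).
    { replace (q2 * s / dist (P 1%nat) (P 4%nat) ^ 3) with (stress_d P * l - stress_p' P b0 b1)
        by (unfold s, charge_s; fold b0 b1 l; field; lra).
      unfold stress_p', stress_d; field; lra. }
    (* The charges were chosen to match the diagonals 13 and 25; agreement on 35 is exactly the
       quadratic equation for [l]. *)
    assert (E24 : s * t / dist (P 2%nat) (P 4%nat) ^ 3
      = beta2 P b0 b1 * beta4 P b0 b1 / beta3 P b0 b1 - l * (area P 0 1 4 * area P 0 1 2)).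
    { transitivity (stress_e P b0 b1 - stress_f P * l); [rewrite <- E|].
      - unfold s, t, charge_s, charge_t, stress_k; fold b0 b1 l; field; lra.
      - unfold stress_e, stress_f; field; lra. }
    rewrite E02, E14, E24.
    (* The goal is the inequality of beta divided by [beta3] plus [l] times that of nu; both
       multipliers are positive. *)
    apply (Rmult_le_compat_l l) in In; [|lra].
    apply (Rmult_le_compat_l (/ beta3 P b0 b1)) in Ib;
      [|apply Rlt_le, Rinv_0_lt_compat; exact S3].
    match type of Ib with ?x <= _ => match type of In with ?y <= _ =>
      match goal with |- ?z <= _ => replace z with (x + y) by (field; lra) end end end.
    lra.
Qed.

(** * Continuity on the unit interval *)

Lemma cont01_const c : cont01 (fun _ => c).
Proof. intros x _; exact (limit_free (fun _ => c) _ x x). Qed.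

Lemma cont01_id : cont01 (fun x => x).
Proof. intros x _ e He; exists e; split; [exact He|]; now intros y [_ H]. Qed.

Lemma cont01_plus f g : cont01 f -> cont01 g -> cont01 (fun x => f x + g x).
Proof. intros Hf Hg x Hx; apply limit_plus; auto. Qed.

Lemma cont01_opp f : cont01 f -> cont01 (fun x => - f x).
Proof. intros Hf x Hx; apply limit_Ropp; auto. Qed.

Lemma cont01_minus f g : cont01 f -> cont01 g -> cont01 (fun x => f x - g x).
Proof. intros Hf Hg x Hx; apply limit_minus; auto. Qed.

Lemma cont01_mult f g : cont01 f -> cont01 g -> cont01 (fun x => f x * g x).
Proof. intros Hf Hg x Hx; apply limit_mul; auto. Qed.

Lemma cont01_div f g :
  cont01 f -> cont01 g -> (forall x, 0 <= x <= 1 -> g x <> 0) ->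
  cont01 (fun x => f x / g x).
Proof. intros Hf Hg H x Hx; apply limit_mul; [|apply limit_inv]; auto. Qed.

Lemma cont01_pow f n : cont01 f -> cont01 (fun x => f x ^ n).
Proof.
  intro Hf; induction n as [|n IH]; simpl; [apply cont01_const|now apply cont01_mult].
Qed.

Lemma cont01_comp g f :
  (forall x, 0 <= x <= 1 -> continuity_pt g (f x)) -> cont01 f ->
  cont01 (fun x => g (f x)).
Proof.
  intros Hg Hf x Hx e He.
  destruct (Hg x Hx e He) as (d & Hd & H).
  destruct (Hf x Hx d Hd) as (d' & Hd' & H').
  exists d'; split; [exact Hd'|]; intros y Hy.
  (* [continuity_pt] is a limit over points different from the base point, so equal values are
     treated separately. *)
  destruct (Req_dec (f x) (f y)) as [E|E].
  - rewrite <- E. simpl; rewrite Rdist_eq; exact He.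
  - apply H; split; [split; [exact I|exact E]|]. now apply H'.
Qed.

Lemma cont01_sqrt f :
  (forall x, 0 <= x <= 1 -> 0 <= f x) -> cont01 f -> cont01 (fun x => sqrt (f x)).
Proof. intro H; apply cont01_comp; intros x Hx; apply continuity_pt_sqrt; auto. Qed.

Lemma cont01_abs f : cont01 f -> cont01 (fun x => Rabs (f x)).
Proof. apply cont01_comp; intros x _; apply Rcontinuity_abs. Qed.

Lemma Rmin_abs x y : Rmin x y = (x + y - Rabs (x - y)) / 2.
Proof. unfold Rmin, Rabs; destruct (Rle_dec x y), (Rcase_abs (x - y)); lra. Qed.

Lemma cont01_ext f g : (forall x, f x = g x) -> cont01 f -> cont01 g.
Proof. intros E Hf x Hx e He; destruct (Hf x Hx e He) as (d & Hd & H);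
  exists d; split; [exact Hd|]; intros y Hy; rewrite <- !E; auto. Qed.

Lemma cont01_min f g : cont01 f -> cont01 g -> cont01 (fun x => Rmin (f x) (g x)).
Proof.
  intros Hf Hg.
  apply cont01_ext with (f := fun x => (f x + g x - Rabs (f x - g x)) / 2).
  - intro; symmetry; apply Rmin_abs.
  - apply cont01_div; [|apply cont01_const|intros; lra].
    apply cont01_minus; [now apply cont01_plus|]. now apply cont01_abs, cont01_minus.
Qed.

Ltac cont01 :=
  repeat match goal with
    | H : cont01 ?f |- cont01 _ => exact H
    | |- cont01 (fun x => x) => apply cont01_id
    | |- cont01 (fun _ => ?c) => apply (cont01_const c)
    | |- cont01 (fun x => @?f x + @?g x) => apply (cont01_plus f g)
    | |- cont01 (fun x => @?f x - @?g x) => apply (cont01_minus f g)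
    | |- cont01 (fun x => @?f x * @?g x) => apply (cont01_mult f g)
    | |- cont01 (fun x => - @?f x) => apply (cont01_opp f)
    | |- cont01 (fun x => @?f x ^ ?n) => apply (cont01_pow f n)
    | |- cont01 (fun x => Rmin (@?f x) (@?g x)) => apply (cont01_min f g)
    | |- cont01 (fun x => @?f x / @?g x) =>
        apply (cont01_div f g); [| |intros; apply Rgt_not_eq, Rlt_gt]
    | |- cont01 (fun x => sqrt (@?f x)) =>
        apply (cont01_sqrt f); [intros; apply Rlt_le|]
    end.

Lemma cont01_pos_of_nonzero g :
  cont01 g -> 0 < g 0 -> (forall x, 0 <= x <= 1 -> g x <> 0) ->
  forall x, 0 <= x <= 1 -> 0 < g x.
Proof.
  intros Hg H0 Hn x Hx.
  apply Rnot_le_lt; intro Hle.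
  (* [IVT] asks for continuity on the whole line, so [g] is composed with the 1-Lipschitz retraction
     onto the unit interval. The sign is changed because [IVT] wants a negative value at the left
     end. *)
  set (cl := fun y => Rmax 0 (Rmin 1 y)).
  assert (Hcl : forall y, 0 <= cl y <= 1)
    by (intro y; unfold cl, Rmax, Rmin; repeat destruct (Rle_dec _ _); lra).
  assert (Hid : forall y, 0 <= y <= 1 -> cl y = y)
    by (intros y Hy; unfold cl, Rmax, Rmin; repeat destruct (Rle_dec _ _); lra).
  assert (Hlip : forall y z, Rabs (cl y - cl z) <= Rabs (y - z)).
  { intros y z; unfold cl, Rmax, Rmin, Rabs.
    repeat destruct (Rle_dec _ _); repeat destruct (Rcase_abs _); lra. }
  assert (Hc : continuity (fun y => - g (cl y))).
  { intro y; apply continuity_pt_opp with (f := fun y => g (cl y)); intros e He.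
    destruct (Hg (cl y) (Hcl y) e He) as (d & Hd & H).
    exists d; split; [exact Hd|]; intros z [_ Hz].
    apply H; split; [apply Hcl|].
    simpl in *; unfold Rdist in *. specialize (Hlip z y). lra. }
  assert (Hx0 : 0 < x).
  { destruct (Req_dec x 0) as [->|]; lra. }
  assert (Hlt : g x < 0) by (specialize (Hn x Hx); lra).
  destruct (IVT (fun y => - g (cl y)) 0 x Hc Hx0) as (z & Hz & Ez).
  - rewrite Hid; lra.
  - rewrite Hid; lra.
  - apply (Hn z); [lra|]. rewrite Hid in Ez by lra. lra.
Qed.

Lemma cont01_area (P : R -> config) i j k :
  path_cont01 P -> (i < 5)%nat -> (j < 5)%nat -> (k < 5)%nat ->
  cont01 (fun tau => area (P tau) i j k).
Proof.
  intros H Hi Hj Hk. unfold area, cross.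
  destruct (H i Hi), (H j Hj), (H k Hk). cont01.
Qed.

Lemma cont01_dist (P : R -> config) i j :
  path_cont01 P -> (i < 5)%nat -> (j < 5)%nat ->
  cont01 (fun tau => dist (P tau i) (P tau j)).
Proof.
  intros H Hi Hj. destruct (H i Hi), (H j Hj). unfold dist.
  apply cont01_sqrt; [intros; apply (sqd_ge0 (P x i) (P x j))|]. cont01.
Qed.

Lemma cont01_charges (P : R -> config) q1 q2 q4 :
  0 < q1 -> 0 < q2 -> 0 < q4 ->
  path_cont01 P -> (forall tau, 0 <= tau <= 1 -> pos_convex (P tau)) ->
  cont01 (fun tau => charge_s q1 q2 q4 (P tau)) /\
  cont01 (fun tau => charge_t q1 q2 q4 (P tau)).
Proof.
  intros Hq1 Hq2 Hq4 HP H.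
  assert (M : forall x y, 0 < x -> 0 < y -> 0 < x * y) by apply Rmult_lt_0_compat.
  assert (Hd : forall tau i j, 0 <= tau <= 1 -> (i < j)%nat -> (j < 5)%nat ->
    0 < dist (P tau i) (P tau j)) by (intros; apply pos_convex_dist; auto).
  assert (Ca : forall i j k, (i < 5)%nat -> (j < 5)%nat -> (k < 5)%nat ->
    cont01 (fun tau => area (P tau) i j k)) by (intros; now apply cont01_area).
  assert (Cd : forall i j, (i < 5)%nat -> (j < 5)%nat ->
    cont01 (fun tau => dist (P tau i) (P tau j))) by (intros; now apply cont01_dist).
  assert (Cs : forall q q' i j, (i < j)%nat -> (j < 5)%nat ->
    cont01 (fun tau => coulomb_stress q q' (P tau) i j)).
  { intros; unfold coulomb_stress; cont01; [apply Cd; lia|].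
    apply pow_lt, Hd; auto; lia. }
  assert (Ps : forall q q' i j tau, 0 < q -> 0 < q' -> 0 <= tau <= 1 -> (i < j)%nat -> (j < 5)%nat ->
    0 < coulomb_stress q q' (P tau) i j).
  { intros; apply Rdiv_lt_0_compat; [now apply M|apply pow_lt, Hd; auto; lia]. }
  set (b0 := fun tau => coulomb_stress q1 q4 (P tau) 0 3).
  set (b1 := fun tau => coulomb_stress q2 q4 (P tau) 1 3).
  assert (C0 : cont01 b0) by (apply Cs; lia).
  assert (C1 : cont01 b1) by (apply Cs; lia).
  assert (P0 : forall tau, 0 <= tau <= 1 -> 0 < b0 tau) by (intros; apply Ps; auto; lia).
  assert (P1 : forall tau, 0 <= tau <= 1 -> 0 < b1 tau) by (intros; apply Ps; auto; lia).
  assert (A234 : forall tau, 0 <= tau <= 1 -> 0 < area (P tau) 2 3 4)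
    by (intros; apply H; auto; lia).
  assert (C2 : cont01 (fun tau => beta2 (P tau) (b0 tau) (b1 tau)))
    by (unfold beta2; cont01; try (apply Ca; lia); auto).
  assert (C3 : cont01 (fun tau => beta3 (P tau) (b0 tau) (b1 tau)))
    by (unfold beta3; cont01; try (apply Ca; lia); auto).
  assert (C4 : cont01 (fun tau => beta4 (P tau) (b0 tau) (b1 tau)))
    by (unfold beta4; cont01; try (apply Ca; lia); auto).
  assert (S3 : forall tau, 0 <= tau <= 1 -> 0 < beta3 (P tau) (b0 tau) (b1 tau))
    by (intros; apply stress_signs; auto).
  assert (Cb : cont01 (fun tau => stress_b (P tau)))
    by (unfold stress_b; cont01; apply Ca; lia).
  assert (Cdd : cont01 (fun tau => stress_d (P tau)))
    by (unfold stress_d; cont01; apply Ca; lia).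
  assert (Cf : cont01 (fun tau => stress_f (P tau)))
    by (unfold stress_f; cont01; apply Ca; lia).
  assert (Ck : cont01 (fun tau => stress_k q1 q2 (P tau))).
  { unfold stress_k; cont01; try (apply Cd; lia).
    apply M; [now apply M|apply pow_lt, Hd; auto; lia]. }
  assert (Cp : cont01 (fun tau => stress_p (P tau) (b0 tau) (b1 tau)))
    by (unfold stress_p; cont01; auto).
  assert (Cp' : cont01 (fun tau => stress_p' (P tau) (b0 tau) (b1 tau)))
    by (unfold stress_p'; cont01; auto).
  assert (Ce : cont01 (fun tau => stress_e (P tau) (b0 tau) (b1 tau)))
    by (unfold stress_e; cont01; auto).
  assert (Cl : cont01 (fun tau => stress_lambda q1 q2 (P tau) (b0 tau) (b1 tau))).
  { unfold stress_lambda, lambda_root, quad_root, lambda_B; cont01;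
      destruct (stress_lambda_spec q1 q2 (P x) (b0 x) (b1 x)) as (HA & HD & _); auto.
    lra. }
  unfold charge_s, charge_t; split; cont01; try (apply Cd; lia); auto.
Qed.

(** * Connectedness of the space of convex configurations *)

(** Sixteen times the squared area of a triangle with squared sides [z], [r], [s]. *)
Definition heron z r s := 4 * z * r - (z + r - s) ^ 2.

(* The vertex at squared distances [r] from the origin and [s] from [B], where [z = |B|^2];
   [sg = 1] or [-1] selects the side of the line through the origin and [B]. *)
Definition apex (sg : R) (B : point) (z r s : R) : point :=
  let p := (z + r - s) / (2 * z) in
  let h := sg * sqrt (heron z r s) / (2 * z) in
  (p * fst B - h * snd B, p * snd B + h * fst B).

Lemma apex_spec sg B z r s :
  sg ^ 2 = 1 -> sqd (0, 0) B = z -> 0 < z -> 0 < heron z r s ->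
  sqd (0, 0) (apex sg B z r s) = r /\ sqd B (apex sg B z r s) = s /\
  cross (0, 0) B (apex sg B z r s) = sg * sqrt (heron z r s) / 2.
Proof.
  intros Hsg HB Hz Hh.
  assert (Hs : sqrt (heron z r s) ^ 2 = heron z r s)
    by (rewrite <- Rsqr_pow2; apply Rsqr_sqrt; lra).
  set (h := sqrt (heron z r s)) in *.
  assert (E : (sg * h) ^ 2 = heron z r s) by (rewrite Rpow_mult_distr, Hsg, Hs; ring).
  set (k := sg * h) in *.
  destruct B as [x y]; unfold sqd, cross, apex in *; cbn [fst snd] in *; fold h; fold k.
  assert (E' : k ^ 2 + (z + r - s) ^ 2 = 4 * z * r) by (rewrite E; unfold heron; ring).
  assert (HB' : x ^ 2 + y ^ 2 = z) by (rewrite <- HB; ring).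
  assert (E0 : ((z + r - s) / (2 * z) * x - k / (2 * z) * y) ^ 2
      + ((z + r - s) / (2 * z) * y + k / (2 * z) * x) ^ 2 = r).
  { transitivity ((k ^ 2 + (z + r - s) ^ 2) * (x ^ 2 + y ^ 2) / (4 * z ^ 2)); [field; lra|].
    rewrite E', HB'. field; lra. }
  assert (E1 : x * ((z + r - s) / (2 * z) * x - k / (2 * z) * y)
      + y * ((z + r - s) / (2 * z) * y + k / (2 * z) * x) = (z + r - s) / 2).
  { transitivity ((z + r - s) / (2 * z) * (x ^ 2 + y ^ 2)); [ring|].
    rewrite HB'; field; lra. }
  repeat split.
  - rewrite <- E0 at 3. ring.
  - lra.
  - transitivity (k / (2 * z) * (x ^ 2 + y ^ 2)); [ring|]. rewrite HB'; field; lra.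
Qed.

(** Normal form with A_1 at the origin and A_3 on the positive horizontal axis, glued from the
    triangles 123, 134, 145. The sign [-1] puts A_2 below the axis, which makes the fan
    counterclockwise. *)
Definition model (a : nat -> R) (X Y : R) : config :=
  let A2 := (sqrt X, 0) in
  let A3 := apex 1 A2 X Y (a 2%nat ^ 2) in
  fun i => match i with
  | 0%nat => (0, 0)
  | 1%nat => apex (-1) A2 X (a 0%nat ^ 2) (a 1%nat ^ 2)
  | 2%nat => A2
  | 3%nat => A3
  | _ => apex 1 A3 Y (a 4%nat ^ 2) (a 3%nat ^ 2)
  end.

(* With [X = |A_1 A_3|^2] and [Y = |A_1 A_4|^2]: the triangles 123, 134, 145 exist, and the
   angles at [A_3] and [A_4] are less than [pi]; by Stewart's theorem these last two conditions are linear. *)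
Definition region (a : nat -> R) (X Y : R) : Prop :=
  0 < heron X (a 0%nat ^ 2) (a 1%nat ^ 2) /\
  0 < heron X Y (a 2%nat ^ 2) /\
  0 < heron Y (a 4%nat ^ 2) (a 3%nat ^ 2) /\
  0 < a 2%nat * (X + a 1%nat ^ 2 - a 0%nat ^ 2) + a 1%nat * (X + a 2%nat ^ 2 - Y) /\
  0 < a 3%nat * (Y + a 2%nat ^ 2 - X) + a 2%nat * (Y + a 3%nat ^ 2 - a 4%nat ^ 2).

(** For the angles [x = VOU] and [y = WOV] between 0 and pi, the sum is below pi iff
    [cos x + cos y > 0], and the cosine law expresses this by distances. *)
Lemma hinge (O V U W : point) :
  0 < cross O V U -> 0 < cross O W V ->
  (0 < cross O W U <->
   0 < dist O W * (sqd O V + sqd O U - sqd V U) + dist O U * (sqd O V + sqd O W - sqd V W)).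
Proof.
  intros H1 H2.
  assert (Hu : 0 < dist O U) by (apply (cross_dist_pos O V U); lra).
  assert (Hv : 0 < dist O V) by (apply (cross_dist_pos O V U); lra).
  assert (Hw : 0 < dist O W) by (apply (cross_dist_pos O W V); lra).
  pose proof (dist_sqr O U) as Eu. pose proof (dist_sqr O W) as Ew.
  pose proof (dist_sqr O V) as Ev.
  set (lu := dist O U) in *. set (lw := dist O W) in *. set (lv := dist O V) in *.
  set (S1 := cross O V U) in *. set (S2 := cross O W V) in *. set (Z := cross O W U).
  set (C1 := sqd O V + sqd O U - sqd V U). set (C2 := sqd O V + sqd O W - sqd V W).
  set (X := sqd O V) in *.
  assert (Q1 : 4 * S1 ^ 2 + C1 ^ 2 = 4 * X * lu ^ 2)
    by (rewrite Eu; unfold S1, C1, X, cross, sqd; ring).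
  assert (Q2 : 4 * S2 ^ 2 + C2 ^ 2 = 4 * X * lw ^ 2)
    by (rewrite Ew; unfold S2, C2, X, cross, sqd; ring).
  assert (Q3 : 2 * X * Z = S2 * C1 + C2 * S1)
    by (unfold S1, S2, C1, C2, X, Z, cross, sqd; ring).
  assert (HX : 0 < X) by (rewrite <- Ev; now apply pow_lt).
  clearbody lu lw lv S1 S2 Z C1 C2 X.
  (* A scaled form of [sin (x + y) (1 + cos (x - y)) = (sin x + sin y) (cos x + cos y)]. *)
  assert (I : (4 * X * lu * lw + C1 * C2 + 4 * S1 * S2) * Z
    = 2 * (lw * S1 + lu * S2) * (lw * C1 + lu * C2)).
  { apply (Rmult_eq_reg_l (2 * X)); [|lra].
    transitivity ((4 * X * lu * lw + C1 * C2 + 4 * S1 * S2) * (2 * X * Z)); [ring|].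
    rewrite Q3.
    transitivity (4 * X * lu * lw * (S2 * C1 + C2 * S1) + S2 * C2 * (4 * S1 ^ 2 + C1 ^ 2)
      + S1 * C1 * (4 * S2 ^ 2 + C2 ^ 2)); [ring|].
    rewrite Q1, Q2; ring. }
  assert (N : 0 < 4 * X * lu * lw + C1 * C2 + 4 * S1 * S2).
  { assert (0 < S1 * S2) by now apply Rmult_lt_0_compat.
    assert (0 <= 4 * X * lu * lw + C1 * C2); [|lra].
    assert (L : Rabs (C1 * C2) <= Rabs (4 * X * lu * lw)).
    { apply Rsqr_le_abs_0. rewrite !Rsqr_pow2, Rpow_mult_distr.
      replace ((4 * X * lu * lw) ^ 2) with ((4 * X * lu ^ 2) * (4 * X * lw ^ 2)) by ring.
      pose proof (pow2_ge_0 S1). pose proof (pow2_ge_0 S2).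
      apply Rmult_le_compat; try apply pow2_ge_0; lra. }
    rewrite (Rabs_right (4 * X * lu * lw)) in L
      by (apply Rle_ge; repeat apply Rmult_le_pos; lra).
    pose proof (Rle_abs (- (C1 * C2))) as L'. rewrite Rabs_Ropp in L'. lra. }
  assert (N' : 0 < 2 * (lw * S1 + lu * S2)).
  { assert (0 < lw * S1) by now apply Rmult_lt_0_compat.
    assert (0 < lu * S2) by now apply Rmult_lt_0_compat. lra. }
  split; intro H.
  - apply (Rmult_lt_reg_l (2 * (lw * S1 + lu * S2))); [exact N'|].
    rewrite <- I, Rmult_0_r. now apply Rmult_lt_0_compat.
  - apply (Rmult_lt_reg_l (4 * X * lu * lw + C1 * C2 + 4 * S1 * S2)); [exact N|].
    rewrite I, Rmult_0_r. now apply Rmult_lt_0_compat.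
Qed.

Lemma in_M_sides a P :
  in_M a P -> dist (P 0%nat) (P 1%nat) = a 0%nat /\ dist (P 1%nat) (P 2%nat) = a 1%nat /\
  dist (P 2%nat) (P 3%nat) = a 2%nat /\ dist (P 3%nat) (P 4%nat) = a 3%nat /\
  dist (P 0%nat) (P 4%nat) = a 4%nat.
Proof.
  intro H. repeat split.
  - apply (H 0%nat); lia.
  - apply (H 1%nat); lia.
  - apply (H 2%nat); lia.
  - apply (H 3%nat); lia.
  - rewrite dist_sym. apply (H 4%nat); lia.
Qed.

Lemma in_M_sqd a P :
  in_M a P -> sqd (P 0%nat) (P 1%nat) = a 0%nat ^ 2 /\ sqd (P 1%nat) (P 2%nat) = a 1%nat ^ 2 /\
  sqd (P 2%nat) (P 3%nat) = a 2%nat ^ 2 /\ sqd (P 3%nat) (P 4%nat) = a 3%nat ^ 2 /\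
  sqd (P 0%nat) (P 4%nat) = a 4%nat ^ 2.
Proof.
  intro H. destruct (in_M_sides a P H) as (H0 & H1 & H2 & H3 & H4).
  rewrite <- !dist_sqr, H0, H1, H2, H3, H4. auto.
Qed.

Lemma hinges a P :
  in_M a P -> 0 < area P 0 1 2 -> 0 < area P 0 2 3 -> 0 < area P 0 3 4 ->
  let X := sqd (P 0%nat) (P 2%nat) in let Y := sqd (P 0%nat) (P 3%nat) in
  (0 < area P 1 2 3 <->
    0 < a 2%nat * (X + a 1%nat ^ 2 - a 0%nat ^ 2) + a 1%nat * (X + a 2%nat ^ 2 - Y)) /\
  (0 < area P 2 3 4 <->
    0 < a 3%nat * (Y + a 2%nat ^ 2 - X) + a 2%nat * (Y + a 3%nat ^ 2 - a 4%nat ^ 2)).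
Proof.
  intros HM H0 H1 H2 X Y.
  destruct (in_M_sides a P HM) as (D0 & D1 & D2 & D3 & D4).
  destruct (in_M_sqd a P HM) as (E0 & E1 & E2 & E3 & E4).
  unfold area in *. split.
  - rewrite <- (cross_rot (P 1%nat)).
    rewrite (hinge (P 2%nat) (P 0%nat) (P 1%nat) (P 3%nat)).
    + rewrite (dist_sym (P 2%nat) (P 1%nat)), (sqd_sym (P 2%nat) (P 1%nat)),
        (sqd_sym (P 2%nat) (P 0%nat)), D1, D2, E0, E1, E2. reflexivity.
    + now rewrite <- (cross_rot (P 2%nat)).
    + now rewrite (cross_rot (P 0%nat)).
  - rewrite <- (cross_rot (P 2%nat)).
    rewrite (hinge (P 3%nat) (P 0%nat) (P 2%nat) (P 4%nat)).
    + rewrite (dist_sym (P 3%nat) (P 2%nat)), (sqd_sym (P 3%nat) (P 2%nat)),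
        (sqd_sym (P 3%nat) (P 0%nat)), D2, D3, E2, E3, E4. reflexivity.
    + now rewrite <- (cross_rot (P 3%nat)).
    + now rewrite (cross_rot (P 0%nat)).
Qed.

Lemma region_of_pos_convex a P :
  in_M a P -> pos_convex P ->
  region a (sqd (P 0%nat) (P 2%nat)) (sqd (P 0%nat) (P 3%nat)).
Proof.
  intros HM H.
  destruct (in_M_sqd a P HM) as (E0 & E1 & E2 & E3 & E4).
  destruct (hinges a P HM) as [h1 h2]; try (apply H; lia).
  assert (K : forall p q r, cross p q r <> 0 -> 0 < heron (sqd p q) (sqd p r) (sqd q r)).
  { intros p q r Hc. unfold heron. rewrite <- heron_cross.
    apply Rmult_lt_0_compat; [lra|]. rewrite <- Rsqr_pow2. now apply Rsqr_pos_lt. }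
  repeat split; [| | |apply h1, H; lia|apply h2, H; lia].
  - rewrite <- E0, <- E1, (sqd_sym (P 1%nat)). apply K.
    assert (0 < cross (P 0%nat) (P 1%nat) (P 2%nat)) by (apply H; lia).
    replace (cross (P 0%nat) (P 2%nat) (P 1%nat)) with (- cross (P 0%nat) (P 1%nat) (P 2%nat))
      by (unfold cross; ring). lra.
  - rewrite <- E2. apply K. apply Rgt_not_eq, H; lia.
  - rewrite <- E3, <- E4. apply K. apply Rgt_not_eq, H; lia.
Qed.

Lemma heron_pos_arg z r s : 0 <= r -> 0 < heron z r s -> 0 < z.
Proof.
  unfold heron; intros Hr H. pose proof (pow2_ge_0 (z + r - s)) as h.
  apply Rnot_le_lt; intro Hz.
  assert (0 <= (- z) * r) by (apply Rmult_le_pos; lra). lra.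
Qed.

Lemma region_pos a X Y : region a X Y -> 0 < X /\ 0 < Y.
Proof.
  intros (H1 & _ & H3 & _); split; eapply heron_pos_arg; eauto; apply pow2_ge_0.
Qed.

Lemma model_spec a X Y :
  (forall i, (i < 5)%nat -> 0 < a i) -> region a X Y ->
  in_M a (model a X Y) /\
  sqd (model a X Y 0%nat) (model a X Y 2%nat) = X /\
  sqd (model a X Y 0%nat) (model a X Y 3%nat) = Y /\
  0 < area (model a X Y) 0 1 2 /\ 0 < area (model a X Y) 0 2 3 /\
  0 < area (model a X Y) 0 3 4 /\ 0 < area (model a X Y) 1 2 3 /\
  0 < area (model a X Y) 2 3 4.
Proof.
  intros Ha HR. destruct (region_pos a X Y HR) as [HX HY].
  destruct HR as (H1 & H2 & H3 & H4 & H5).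
  set (P := model a X Y).
  assert (E02 : sqd (P 0%nat) (P 2%nat) = X).
  { unfold P, model, sqd; cbn [fst snd].
    replace ((0 - sqrt X) ^ 2 + (0 - 0) ^ 2) with (sqrt X ^ 2) by ring.
    rewrite <- Rsqr_pow2. apply Rsqr_sqrt; lra. }
  destruct (apex_spec (-1) (P 2%nat) X _ _ ltac:(ring) E02 HX H1) as (E01 & E21 & C021).
  destruct (apex_spec 1 (P 2%nat) X _ _ ltac:(ring) E02 HX H2) as (E03 & E23 & C023).
  destruct (apex_spec 1 (P 3%nat) Y _ _ ltac:(ring) E03 HY H3) as (E04 & E34 & C034).
  change (apex (-1) (P 2%nat) X (a 0%nat ^ 2) (a 1%nat ^ 2)) with (P 1%nat) in *.
  change (apex 1 (P 2%nat) X Y (a 2%nat ^ 2)) with (P 3%nat) in *.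
  change (apex 1 (P 3%nat) Y (a 4%nat ^ 2) (a 3%nat ^ 2)) with (P 4%nat) in *.
  change (0, 0) with (P 0%nat) in *.
  assert (HM : in_M a P).
  { assert (S : forall p q i, (i < 5)%nat -> sqd p q = a i ^ 2 -> dist p q = a i).
    { intros p q i Hi E. change (sqrt (sqd p q) = a i). rewrite E.
      apply sqrt_pow2. specialize (Ha i Hi); lra. }
    intros i Hi.
    assert (Ci : (i = 0 \/ i = 1 \/ i = 2 \/ i = 3 \/ i = 4)%nat) by lia.
    destruct Ci as [->|[->|[->|[->| ->]]]]; apply S; auto.
    - now rewrite sqd_sym.
    - now rewrite sqd_sym. }
  assert (sqrt_pos : forall x, 0 < x -> 0 < sqrt x) by (intros; now apply sqrt_lt_R0).
  assert (A012 : 0 < area P 0 1 2).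
  { apply sqrt_pos in H1. unfold area.
    replace (cross (P 0%nat) (P 1%nat) (P 2%nat)) with (- cross (P 0%nat) (P 2%nat) (P 1%nat))
      by (unfold cross; ring). rewrite C021. lra. }
  assert (A023 : 0 < area P 0 2 3) by (apply sqrt_pos in H2; unfold area; lra).
  assert (A034 : 0 < area P 0 3 4) by (apply sqrt_pos in H3; unfold area; lra).
  destruct (hinges a P HM A012 A023 A034) as [h1 h2]. rewrite E02, E03 in h1, h2.
  tauto.
Qed.

(** The two missing triples, 124 and 134 in the indices of [P], follow from Plücker relations whose
    other terms are positive. *)
Lemma pos_convex_of_fan P :
  0 < area P 0 1 2 -> 0 < area P 0 2 3 -> 0 < area P 0 3 4 ->
  0 < area P 1 2 3 -> 0 < area P 2 3 4 ->
  0 < area P 0 1 3 -> 0 < area P 0 2 4 -> 0 < area P 0 1 4 -> pos_convex P.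
Proof.
  intros H012 H023 H034 H123 H234 H013 H024 H014.
  assert (M : forall x y, 0 < x -> 0 < y -> 0 < x * y) by apply Rmult_lt_0_compat.
  assert (H124 : 0 < area P 1 2 4).
  { apply (Rmult_lt_reg_l (area P 0 2 3)); [exact H023|].
    replace (area P 0 2 3 * area P 1 2 4)
      with (area P 0 2 4 * area P 1 2 3 + area P 0 1 2 * area P 2 3 4)
      by (unfold area, cross; ring).
    rewrite Rmult_0_r. apply Rplus_lt_0_compat; now apply M. }
  assert (H134 : 0 < area P 1 3 4).
  { apply (Rmult_lt_reg_l (area P 0 2 3)); [exact H023|].
    replace (area P 0 2 3 * area P 1 3 4)
      with (area P 0 1 3 * area P 2 3 4 + area P 0 3 4 * area P 1 2 3)
      by (unfold area, cross; ring).
    rewrite Rmult_0_r. apply Rplus_lt_0_compat; now apply M. }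
  intros i j k Hij Hjk Hk.
  destruct i as [|[|[|i]]]; destruct j as [|[|[|[|j]]]]; try lia;
    destruct k as [|[|[|[|[|k]]]]]; try lia; assumption.
Qed.

(* The stress carried by the sides and the diagonals 13, 14, 25 is positive on these diagonals. *)
Lemma sqd14_antitone a P Q :
  in_M a P -> in_M a Q -> pos_convex P ->
  sqd (P 0%nat) (P 2%nat) <= sqd (Q 0%nat) (Q 2%nat) ->
  sqd (P 0%nat) (P 3%nat) <= sqd (Q 0%nat) (Q 3%nat) ->
  sqd (Q 1%nat) (Q 4%nat) <= sqd (P 1%nat) (P 4%nat).
Proof.
  intros HM HQ H L02 L03.
  assert (Pp : forall i j k, (i < j)%nat -> (j < k)%nat -> (k < 5)%nat -> 0 < area P i j k)
    by exact H.
  assert (M : forall x y, 0 < x -> 0 < y -> 0 < x * y) by apply Rmult_lt_0_compat.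
  assert (A234 : 0 < area P 2 3 4) by (apply Pp; lia).
  pose proof (dependency_diag_incr a P Q _ _ _ _ _ HM HQ
    (dependency_beta P 1 0 ltac:(lra))) as Ib.
  pose proof (dependency_diag_incr a P Q _ _ _ _ _ HM HQ (dependency_nu P)) as In.
  assert (S2 : beta2 P 1 0 < 0).
  { unfold beta2; rewrite Rdiv_opp_l.
    enough (0 < (1 * area P 0 3 4 + 0 * area P 1 3 4) / area P 2 3 4) by lra.
    apply Rdiv_lt_0_compat; [|exact A234]. rewrite Rmult_0_l, Rmult_1_l, Rplus_0_r. apply Pp; lia. }
  assert (S3 : 0 < beta3 P 1 0).
  { unfold beta3. apply Rdiv_lt_0_compat; [|exact A234].
    rewrite Rmult_0_l, Rmult_1_l, Rplus_0_r. apply Pp; lia. }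
  assert (S4 : beta4 P 1 0 < 0).
  { unfold beta4; rewrite Rdiv_opp_l.
    enough (0 < (1 * area P 0 2 3 + 0 * area P 1 2 3) / area P 2 3 4) by lra.
    apply Rdiv_lt_0_compat; [|exact A234]. rewrite Rmult_0_l, Rmult_1_l, Rplus_0_r. apply Pp; lia. }
  (* This sign makes the coefficient of the diagonal 13 positive in the combination below. *)
  assert (S : area P 0 1 2 + beta4 P 1 0 * area P 1 2 4 < 0).
  { replace (area P 0 1 2 + beta4 P 1 0 * area P 1 2 4)
      with (- (area P 0 2 4 * area P 1 2 3 / area P 2 3 4)).
    - enough (0 < area P 0 2 4 * area P 1 2 3 / area P 2 3 4) by lra.
      apply Rdiv_lt_0_compat; [apply M; apply Pp; lia|exact A234].
    - unfold beta4. apply (Rmult_eq_reg_r (area P 2 3 4)); [|lra].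
      field_simplify; [|lra|lra]. unfold area, cross; ring. }
  assert (F : 0 < area P 0 1 4 * area P 0 1 2) by (apply M; apply Pp; lia).
  assert (G : 0 < area P 0 2 4 * area P 0 1 2) by (apply M; apply Pp; lia).
  assert (A014 : 0 < area P 0 1 4) by (apply Pp; lia).
  (* This multiplier and the one for [In] cancel the diagonal 35. The diagonal 24 is absent from
     both inequalities, since beta has entry 0 at A_2 and nu has entry 0 at A_4. *)
  apply (Rmult_le_compat_l (area P 0 1 4 * area P 0 1 2)) in Ib; [|lra].
  assert (N24 : 0 < beta2 P 1 0 * beta4 P 1 0).
  { replace (beta2 P 1 0 * beta4 P 1 0) with (- beta2 P 1 0 * - beta4 P 1 0) by ring.
    apply M; lra. }
  apply (Rmult_le_compat_l (beta2 P 1 0 * beta4 P 1 0)) in In; [|lra].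
  assert (T02 : 0 <= (- beta2 P 1 0 * area P 0 1 4
      * - (area P 0 1 2 + beta4 P 1 0 * area P 1 2 4)) * diag_incr P Q 0 2).
  { apply Rmult_le_pos; [apply Rlt_le, M; [apply M|]; lra|unfold diag_incr; lra]. }
  assert (T03 : 0 <= area P 0 1 4 * area P 0 1 2 * beta3 P 1 0 * diag_incr P Q 0 3).
  { apply Rmult_le_pos; [apply Rlt_le, M; lra|unfold diag_incr; lra]. }
  apply Rnot_lt_le; intro Hlt.
  assert (T14 : 0 < beta2 P 1 0 * beta4 P 1 0 * (area P 0 2 4 * area P 0 1 2) * diag_incr P Q 1 4).
  { apply M; [now apply M|unfold diag_incr; lra]. }
  lra.
Qed.

Lemma model_path_cont01 a x y :
  cont01 x -> cont01 y -> (forall tau, 0 <= tau <= 1 -> region a (x tau) (y tau)) ->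
  path_cont01 (fun tau => model a (x tau) (y tau)).
Proof.
  intros Hx Hy HR.
  assert (Px : forall tau, 0 <= tau <= 1 -> 0 < x tau) by (intros tau Ht; apply (region_pos a (x tau) (y tau)); auto).
  assert (Py : forall tau, 0 <= tau <= 1 -> 0 < y tau) by (intros tau Ht; apply (region_pos a (x tau) (y tau)); auto).
  assert (Cap : forall sg (bx by_ z r s : R -> R),
    cont01 bx -> cont01 by_ -> cont01 z -> cont01 r -> cont01 s ->
    (forall tau, 0 <= tau <= 1 -> 0 < z tau) ->
    (forall tau, 0 <= tau <= 1 -> 0 < heron (z tau) (r tau) (s tau)) ->
    cont01 (fun tau => fst (apex sg (bx tau, by_ tau) (z tau) (r tau) (s tau))) /\
    cont01 (fun tau => snd (apex sg (bx tau, by_ tau) (z tau) (r tau) (s tau)))).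
  { intros sg bx by_ z r s Cx Cy Cz Cr Cs Pz Ph.
    assert (Ch : cont01 (fun tau => heron (z tau) (r tau) (s tau))) by (unfold heron; cont01).
    assert (Q : forall tau, 0 <= tau <= 1 -> 0 < 2 * z tau)
      by (intros tau Ht; specialize (Pz tau Ht); lra).
    unfold apex; cbn [fst snd]; split; cont01; auto. }
  set (A3 := fun tau => model a (x tau) (y tau) 3%nat).
  destruct (Cap (-1) (fun tau => sqrt (x tau)) (fun _ => 0) x (fun _ => a 0%nat ^ 2)
    (fun _ => a 1%nat ^ 2)) as [C1 C1']; cont01; auto; [intros; apply HR; auto|].
  destruct (Cap 1 (fun tau => sqrt (x tau)) (fun _ => 0) x y
    (fun _ => a 2%nat ^ 2)) as [C3 C3']; cont01; auto; [intros; apply HR; auto|].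
  change (cont01 (fun tau => fst (A3 tau))) in C3.
  change (cont01 (fun tau => snd (A3 tau))) in C3'.
  destruct (Cap 1 (fun tau => fst (A3 tau)) (fun tau => snd (A3 tau)) y (fun _ => a 4%nat ^ 2)
    (fun _ => a 3%nat ^ 2)) as [C4 C4']; cont01; auto; [intros; apply HR; auto|].
  intros i Hi; destruct i as [|[|[|[|i]]]]; split; auto; cbn [model fst snd]; cont01; auto.
Qed.

(** * Convexity of the region, joins, and segments going up *)

Lemma convex_comb_pos x x' tau :
  0 <= tau <= 1 -> 0 < x -> 0 < x' -> 0 < (1 - tau) * x + tau * x'.
Proof.
  intros Ht Hx Hx'. destruct (Req_dec tau 0) as [->|h]; [lra|].
  assert (0 <= (1 - tau) * x) by (apply Rmult_le_pos; lra).
  assert (0 < tau * x') by (apply Rmult_lt_0_compat; lra). lra.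
Qed.

(** For fixed [s] the quadratic part of [heron] in [(z, r)] is [- (z - r) ^ 2], so [heron] is
    concave. *)
Lemma heron_concave z r z' r' s tau :
  0 <= tau <= 1 -> 0 < heron z r s -> 0 < heron z' r' s ->
  0 < heron (z + tau * (z' - z)) (r + tau * (r' - r)) s.
Proof.
  intros Ht H H'.
  replace (heron (z + tau * (z' - z)) (r + tau * (r' - r)) s)
    with ((1 - tau) * heron z r s + tau * heron z' r' s
      + tau * (1 - tau) * (z' - z - (r' - r)) ^ 2)
    by (unfold heron; ring).
  apply Rplus_lt_le_0_compat; [now apply convex_comb_pos|].
  apply Rmult_le_pos; [apply Rmult_le_pos; lra|apply pow2_ge_0].
Qed.

Lemma region_convex a X Y X' Y' tau :
  0 <= tau <= 1 -> region a X Y -> region a X' Y' ->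
  region a (X + tau * (X' - X)) (Y + tau * (Y' - Y)).
Proof.
  intros Ht (H1 & H2 & H3 & H4 & H5) (H1' & H2' & H3' & H4' & H5').
  repeat split.
  - pose proof (heron_concave _ _ _ _ _ tau Ht H1 H1') as h.
    now rewrite Rminus_diag, Rmult_0_r, Rplus_0_r in h.
  - now apply heron_concave.
  - pose proof (heron_concave _ _ _ _ _ tau Ht H3 H3') as h.
    now rewrite Rminus_diag, Rmult_0_r, Rplus_0_r in h.
  - pose proof (convex_comb_pos _ _ tau Ht H4 H4'). lra.
  - pose proof (convex_comb_pos _ _ tau Ht H5 H5'). lra.
Qed.

(** Positivity reads [(X + s - Y) ^ 2 < 4 X s]. If [X + s - Y'] is nonnegative, raising [Y] to [Y']
    only shrinks the square; otherwise raising [X'] to [X] shrinks it and enlarges the right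
    side. *)
Lemma heron_mixed X Y X' Y' s :
  0 <= s -> 0 < heron X Y s -> 0 < heron X' Y' s -> X' <= X -> Y <= Y' ->
  0 < heron X Y' s.
Proof.
  intros Hs H H' HX HY.
  assert (E : forall x y, heron x y s = 4 * (x * s) - (x + s - y) ^ 2)
    by (intros; unfold heron; ring).
  rewrite E in *.
  assert (X' * s <= X * s) by (apply Rmult_le_compat_r; lra).
  destruct (Rle_dec 0 (X + s - Y')) as [h|h].
  - assert ((X + s - Y') ^ 2 <= (X + s - Y) ^ 2) by (apply pow_incr; lra). lra.
  - assert ((- (X + s - Y')) ^ 2 <= (- (X' + s - Y')) ^ 2) by (apply pow_incr; lra). lra.
Qed.

(* The upper bounds on [X] increase with [Y] and vice versa, so the region is stable under joins. *)
Lemma region_mixed a X Y X' Y' :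
  (forall i, (i < 5)%nat -> 0 < a i) ->
  region a X Y -> region a X' Y' -> X' <= X -> Y <= Y' -> region a X Y'.
Proof.
  intros Ha (H1 & H2 & H3 & H4 & H5) (H1' & H2' & H3' & H4' & H5') HX HY.
  assert (a1 := Ha 1%nat ltac:(lia)). assert (a2 := Ha 2%nat ltac:(lia)).
  assert (a3 := Ha 3%nat ltac:(lia)).
  repeat split; auto.
  - apply heron_mixed with Y X'; auto. apply pow2_ge_0.
  - assert (a 2%nat * X' <= a 2%nat * X) by (apply Rmult_le_compat_l; lra).
    assert (a 1%nat * X' <= a 1%nat * X) by (apply Rmult_le_compat_l; lra). lra.
  - assert (a 2%nat * Y <= a 2%nat * Y') by (apply Rmult_le_compat_l; lra).
    assert (a 3%nat * Y <= a 3%nat * Y') by (apply Rmult_le_compat_l; lra). lra.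
Qed.

Lemma region_join a X Y X' Y' :
  (forall i, (i < 5)%nat -> 0 < a i) ->
  region a X Y -> region a X' Y' -> region a (Rmax X X') (Rmax Y Y').
Proof.
  intros Ha H H'. unfold Rmax.
  destruct (Rle_dec X X'), (Rle_dec Y Y'); auto.
  - apply region_mixed with Y' X; auto; lra.
  - apply region_mixed with Y X'; auto; lra.
Qed.

(* A degenerate limit would have the angle at [A_1] equal to [pi], that is [|A_2 A_5| = a_1 + a_5]. *)
Lemma fan_nondegenerate a P Q :
  in_M a P -> pos_convex P -> in_M a Q ->
  (forall i, (i < 5)%nat -> 0 < a i) ->
  sqd (P 0%nat) (P 2%nat) <= sqd (Q 0%nat) (Q 2%nat) ->
  sqd (P 0%nat) (P 3%nat) <= sqd (Q 0%nat) (Q 3%nat) ->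
  0 < area Q 0 1 2 -> 0 < area Q 0 2 3 -> 0 < area Q 0 3 4 ->
  0 <= area Q 0 1 4 -> 0 <= area Q 0 1 3 -> 0 <= area Q 0 2 4 ->
  0 < area Q 0 1 4 /\ 0 < area Q 0 1 3 /\ 0 < area Q 0 2 4.
Proof.
  intros HP Hc HQ Ha L02 L03 Q012 Q023 Q034 Q014 Q013 Q024.
  (* By this Plücker relation the areas 013 and 024 cannot vanish, which leaves only the angle at
     A_1. *)
  assert (G : 0 < area Q 0 1 3 * area Q 0 2 4).
  { replace (area Q 0 1 3 * area Q 0 2 4)
      with (area Q 0 1 2 * area Q 0 3 4 + area Q 0 1 4 * area Q 0 2 3)
      by (unfold area, cross; ring).
    apply Rplus_lt_le_0_compat; [now apply Rmult_lt_0_compat|apply Rmult_le_pos; lra]. }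
  assert (P013 : 0 < area Q 0 1 3).
  { destruct (Rle_lt_or_eq_dec _ _ Q013) as [h|h]; [exact h|rewrite <- h in G; lra]. }
  assert (P024 : 0 < area Q 0 2 4).
  { destruct (Rle_lt_or_eq_dec _ _ Q024) as [h|h]; [exact h|rewrite <- h in G; lra]. }
  repeat split; auto.
  destruct (Rle_lt_or_eq_dec _ _ Q014) as [h|h]; [exact h|exfalso].
  pose proof (sqd14_antitone a P Q HP HQ Hc L02 L03) as L14.
  destruct (in_M_sqd a P HP) as (E0 & _ & _ & _ & E4).
  destruct (in_M_sqd a Q HQ) as (F0 & _ & _ & _ & F4).
  (* Twice the inner product of the sides at A_1. If the area 014 of [Q] vanished, [ip Q] would be
     negative with the extreme square [4 a_1^2 a_5^2]; but [ip P <= ip Q < 0], and the square of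
     [ip P] is strictly smaller. *)
  set (ip := fun C : config => a 0%nat ^ 2 + a 4%nat ^ 2 - sqd (C 1%nat) (C 4%nat)).
  assert (IP : forall C : config, sqd (C 0%nat) (C 1%nat) = a 0%nat ^ 2 ->
      sqd (C 0%nat) (C 4%nat) = a 4%nat ^ 2 ->
      ip C ^ 2 + 4 * area C 0 1 4 ^ 2 = 4 * a 0%nat ^ 2 * a 4%nat ^ 2
      /\ area C 0 3 4 * (2 * a 0%nat ^ 2) + area C 0 1 3 * ip C
         = area C 0 1 4 * (sqd (C 0%nat) (C 1%nat) + sqd (C 0%nat) (C 3%nat) - sqd (C 1%nat) (C 3%nat))).
  { intros C E E'; unfold ip; rewrite <- E, <- E'; unfold area, cross, sqd; split; ring. }
  destruct (IP P E0 E4) as [IP1 _]. destruct (IP Q F0 F4) as [IQ1 IQ2].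
  rewrite <- h in IQ1, IQ2.
  assert (a0 := Ha 0%nat ltac:(lia)). assert (a4 := Ha 4%nat ltac:(lia)).
  assert (N : ip Q < 0).
  { apply (Rmult_lt_reg_l (area Q 0 1 3)); [exact P013|].
    assert (0 < area Q 0 3 4 * (2 * a 0%nat ^ 2))
      by (apply Rmult_lt_0_compat; [lra|apply Rmult_lt_0_compat; [lra|now apply pow_lt]]). lra. }
  assert (LL : ip P <= ip Q) by (unfold ip; lra).
  assert (P014 : 0 < area P 0 1 4) by (apply Hc; lia).
  assert (0 < area P 0 1 4 ^ 2) by now apply pow_lt.
  assert ((- ip Q) ^ 2 <= (- ip P) ^ 2) by (apply pow_incr; lra).
  lra.
Qed.

(** The region already makes five areas positive. The minimum of the three others in
    [pos_convex_of_fan] is continuous, positive at the start, and never zero by [fan_nondegenerate]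
    applied against the starting pentagon. *)
Lemma pos_convex_up_segment a X Y X' Y' :
  (forall i, (i < 5)%nat -> 0 < a i) ->
  region a X Y -> region a X' Y' -> X <= X' -> Y <= Y' ->
  pos_convex (model a X Y) ->
  forall tau, 0 <= tau <= 1 ->
    pos_convex (model a (X + tau * (X' - X)) (Y + tau * (Y' - Y))).
Proof.
  intros Ha HR HR' HX HY Hc.
  set (M := fun tau => model a (X + tau * (X' - X)) (Y + tau * (Y' - Y))).
  assert (HRt : forall tau, 0 <= tau <= 1 ->
    region a (X + tau * (X' - X)) (Y + tau * (Y' - Y))) by (intros; now apply region_convex).
  assert (CM : path_cont01 M) by (apply model_path_cont01; [cont01|cont01|exact HRt]).
  destruct (model_spec a X Y Ha HR) as (HM & E02 & E03 & _).
  set (g := fun tau => Rmin (area (M tau) 0 1 4) (Rmin (area (M tau) 0 1 3) (area (M tau) 0 2 4))).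
  assert (Hg : forall tau, 0 <= tau <= 1 -> 0 < g tau).
  { apply cont01_pos_of_nonzero.
    - unfold g; cont01; apply cont01_area; auto; lia.
    - unfold g, M. rewrite !Rmult_0_l, !Rplus_0_r.
      repeat apply Rmin_glb_lt; apply Hc; lia.
    - intros tau Ht E.
      destruct (model_spec a _ _ Ha (HRt tau Ht)) as (HMt & F02 & F03 & A012 & A023 & A034 & _).
      fold (M tau) in HMt, F02, F03, A012, A023, A034.
      assert (I1 := Rmult_le_pos tau (X' - X) ltac:(lra) ltac:(lra)).
      assert (I2 := Rmult_le_pos tau (Y' - Y) ltac:(lra) ltac:(lra)).
      unfold g in E.
      pose proof (Rmin_l (area (M tau) 0 1 4) (Rmin (area (M tau) 0 1 3) (area (M tau) 0 2 4))) as m1.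
      pose proof (Rmin_r (area (M tau) 0 1 4) (Rmin (area (M tau) 0 1 3) (area (M tau) 0 2 4))) as m2.
      pose proof (Rmin_l (area (M tau) 0 1 3) (area (M tau) 0 2 4)) as m3.
      pose proof (Rmin_r (area (M tau) 0 1 3) (area (M tau) 0 2 4)) as m4.
      destruct (fan_nondegenerate a (model a X Y) (M tau)) as (p1 & p2 & p3);
        auto; try lra.
      assert (0 < Rmin (area (M tau) 0 1 4) (Rmin (area (M tau) 0 1 3) (area (M tau) 0 2 4)))
        by (repeat apply Rmin_glb_lt; assumption).
      lra. }
  intros tau Ht. specialize (Hg tau Ht). unfold g in Hg.
  pose proof (Rmin_l (area (M tau) 0 1 4) (Rmin (area (M tau) 0 1 3) (area (M tau) 0 2 4))) as m1.
  pose proof (Rmin_r (area (M tau) 0 1 4) (Rmin (area (M tau) 0 1 3) (area (M tau) 0 2 4))) as m2.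
  pose proof (Rmin_l (area (M tau) 0 1 3) (area (M tau) 0 2 4)) as m3.
  pose proof (Rmin_r (area (M tau) 0 1 3) (area (M tau) 0 2 4)) as m4.
  destruct (model_spec a _ _ Ha (HRt tau Ht)) as (_ & _ & _ & A012 & A023 & A034 & A123 & A234).
  apply pos_convex_of_fan; auto; fold (M tau); lra.
Qed.

(** The isometry matching the triangle A_1 A_3 A_4 preserves orientation because both triangles have
    the same positive area. Hence it puts A_2 and A_5 on the right sides of the diagonals 13 and
    14. *)
Lemma model_congruent a P :
  (forall i, (i < 5)%nat -> 0 < a i) -> in_M a P -> pos_convex P ->
  let N := model a (sqd (P 0%nat) (P 2%nat)) (sqd (P 0%nat) (P 3%nat)) in
  pos_convex N /\ congruent N P.
Proof.
  intros Ha HM Hc N.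
  destruct (model_spec a _ _ Ha (region_of_pos_convex a P HM Hc))
    as (HN & E02 & E03 & A012 & A023 & A034 & _).
  fold N in HN, E02, E03, A012, A023, A034.
  destruct (in_M_sqd a P HM) as (p0 & p1 & p2 & p3 & p4).
  destruct (in_M_sqd a N HN) as (n0 & n1 & n2 & n3 & n4).
  assert (P023 : 0 < area P 0 2 3) by (apply Hc; lia).
  destruct (triangle_isometry (N 0%nat) (N 2%nat) (N 3%nat) (P 0%nat) (P 2%nat) (P 3%nat))
    as (f & Hf & f0 & f2 & f3 & fc); auto; [unfold area in A023; lra|congruence|].
  assert (EC : area N 0 2 3 = area P 0 2 3).
  { assert (E : area N 0 2 3 ^ 2 = area P 0 2 3 ^ 2).
    { pose proof (heron_cross (N 0%nat) (N 2%nat) (N 3%nat)) as h1.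
      pose proof (heron_cross (P 0%nat) (P 2%nat) (P 3%nat)) as h2.
      rewrite E02, E03, n2, <- p2, <- h2 in h1. unfold area; lra. }
    apply Rsqr_inj; rewrite ?Rsqr_pow2; lra. }
  assert (fcross : forall u v w, cross (f u) (f v) (f w) = cross u v w).
  { intros u v w. specialize (fc u v w).
    change (cross (N 0%nat) (N 2%nat) (N 3%nat)) with (area N 0 2 3) in fc.
    change (cross (P 0%nat) (P 2%nat) (P 3%nat)) with (area P 0 2 3) in fc.
    rewrite EC in fc. apply (Rmult_eq_reg_r (area P 0 2 3)); lra. }
  assert (fs : forall u v, sqd (f u) (f v) = sqd u v) by (intros; apply dist_eq_iff, Hf).
  assert (f1 : f (N 1%nat) = P 1%nat).
  { apply (point_eq_of_side (P 0%nat) (P 2%nat)).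
    - rewrite <- f0 at 1. rewrite fs; congruence.
    - rewrite <- f2 at 1. rewrite fs, !(sqd_sym _ (_ 1%nat)); congruence.
    - rewrite <- f0 at 1. rewrite <- f2 at 1. rewrite fcross.
      assert (P012 : 0 < area P 0 1 2) by (apply Hc; lia).
      replace (cross (N 0%nat) (N 2%nat) (N 1%nat) * cross (P 0%nat) (P 2%nat) (P 1%nat))
        with (area N 0 1 2 * area P 0 1 2) by (unfold area, cross; ring).
      now apply Rmult_lt_0_compat. }
  assert (f4 : f (N 4%nat) = P 4%nat).
  { apply (point_eq_of_side (P 0%nat) (P 3%nat)).
    - rewrite <- f0 at 1. rewrite fs; congruence.
    - rewrite <- f3 at 1. rewrite fs; congruence.
    - rewrite <- f0 at 1. rewrite <- f3 at 1. rewrite fcross.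
      assert (P034 : 0 < area P 0 3 4) by (apply Hc; lia).
      now apply Rmult_lt_0_compat. }
  assert (fN : forall i, (i < 5)%nat -> f (N i) = P i).
  { intros i Hi. destruct i as [|[|[|[|[|i]]]]]; auto; lia. }
  split.
  - intros i j k Hij Hjk Hk. rewrite <- fcross, !fN by lia. now apply Hc.
  - now exists f.
Qed.

Lemma pos_convex_path a P0 P1 :
  (forall i, (i < 5)%nat -> 0 < a i) ->
  in_M a P0 -> pos_convex P0 -> in_M a P1 -> pos_convex P1 ->
  exists P : R -> config, path_cont01 P /\ congruent (P 0) P0 /\ congruent (P 1) P1 /\
    forall tau, 0 <= tau <= 1 -> in_M a (P tau) /\ pos_convex (P tau).
Proof.
  intros Ha HM0 Hc0 HM1 Hc1.
  pose proof (region_of_pos_convex a P0 HM0 Hc0) as R0.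
  pose proof (region_of_pos_convex a P1 HM1 Hc1) as R1.
  destruct (model_congruent a P0 Ha HM0 Hc0) as [C0 K0].
  destruct (model_congruent a P1 Ha HM1 Hc1) as [C1 K1].
  set (X0 := sqd (P0 0%nat) (P0 2%nat)) in *. set (Y0 := sqd (P0 0%nat) (P0 3%nat)) in *.
  set (X1 := sqd (P1 0%nat) (P1 2%nat)) in *. set (Y1 := sqd (P1 0%nat) (P1 3%nat)) in *.
  pose proof (region_join a X0 Y0 X1 Y1 Ha R0 R1) as RJ.
  pose proof (Rmax_l X0 X1). pose proof (Rmax_r X0 X1).
  pose proof (Rmax_l Y0 Y1). pose proof (Rmax_r Y0 Y1).
  set (XJ := Rmax X0 X1) in *. set (YJ := Rmax Y0 Y1) in *.
  (* On the first half [up] runs from 0 to 1 while [down] stays at 1; on the second half [up] stays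
     at 1 and [down] falls to 0. The point thus rises to the join and then follows backwards the
     rising segment of the target, with a single formula that needs no gluing. *)
  set (up := fun tau => Rmin 1 (2 * tau)). set (down := fun tau => Rmin 1 (2 - 2 * tau)).
  set (x := fun tau => X0 + up tau * (XJ - X0) + (1 - down tau) * (X1 - XJ)).
  set (y := fun tau => Y0 + up tau * (YJ - Y0) + (1 - down tau) * (Y1 - YJ)).
  assert (Cup : cont01 up) by (unfold up; cont01).
  assert (Cdown : cont01 down) by (unfold down; cont01).
  assert (Hseg : forall tau, 0 <= tau <= 1 ->
    region a (x tau) (y tau) /\ pos_convex (model a (x tau) (y tau))).
  { intros tau Ht. destruct (Rle_dec (2 * tau) 1) as [h|h].
    - assert (down tau = 1) as Ed by (apply Rmin_left; lra).
      assert (up tau = 2 * tau) as Eu by (apply Rmin_right; lra).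
      assert (x tau = X0 + 2 * tau * (XJ - X0)) as -> by (unfold x; rewrite Ed, Eu; ring).
      assert (y tau = Y0 + 2 * tau * (YJ - Y0)) as -> by (unfold y; rewrite Ed, Eu; ring).
      split; [apply region_convex; auto; lra|apply pos_convex_up_segment; auto; lra].
    - assert (up tau = 1) as Eu by (apply Rmin_left; lra).
      assert (down tau = 2 - 2 * tau) as Ed by (apply Rmin_right; lra).
      assert (x tau = X1 + (2 - 2 * tau) * (XJ - X1)) as -> by (unfold x; rewrite Ed, Eu; ring).
      assert (y tau = Y1 + (2 - 2 * tau) * (YJ - Y1)) as -> by (unfold y; rewrite Ed, Eu; ring).
      split; [apply region_convex; auto; lra|apply pos_convex_up_segment; auto; lra]. }
  exists (fun tau => model a (x tau) (y tau));
    split; [|split; [|split; [|intros tau Ht; split]]].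
  - apply model_path_cont01; [unfold x; cont01|unfold y; cont01|]; intros; now apply Hseg.
  - assert (down 0 = 1) as Ed by (apply Rmin_left; lra).
    assert (up 0 = 0) as Eu by (unfold up; rewrite Rmin_right; lra).
    assert (x 0 = X0) as -> by (unfold x; rewrite Ed, Eu; ring).
    now assert (y 0 = Y0) as -> by (unfold y; rewrite Ed, Eu; ring).
  - assert (up 1 = 1) as Eu by (apply Rmin_left; lra).
    assert (down 1 = 0) as Ed by (unfold down; rewrite Rmin_right; lra).
    assert (x 1 = X1) as -> by (unfold x; rewrite Ed, Eu; ring).
    now assert (y 1 = Y1) as -> by (unfold y; rewrite Ed, Eu; ring).
  - now apply model_spec, Hseg.
  - now apply Hseg.
Qed.

Theorem theorem4 :
  forall (a : nat -> R) (q1 q2 q4 : R),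
    (forall i, (i < 5)%nat -> 0 < a i) ->
    0 < q1 -> 0 < q2 -> 0 < q4 ->
    forall P0 P1 : config, in_MC a P0 -> in_MC a P1 ->
    exists (s t : R -> R) (P : R -> config),
      cont01 s /\ cont01 t /\ path_cont01 P /\
      congruent (P 0) P0 /\ congruent (P 1) P1 /\
      forall tau, 0 <= tau <= 1 ->
        0 < s tau /\ 0 < t tau /\ in_MC a (P tau) /\
        unique_global_min a q1 q2 q4 (s tau) (t tau) (P tau).
Proof.
  intros a q1 q2 q4 Ha Hq1 Hq2 Hq4 P0 P1 H0 H1.
  destruct (in_MC_pos_convex a P0 H0) as (N0 & M0 & C0 & K0).
  destruct (in_MC_pos_convex a P1 H1) as (N1 & M1 & C1 & K1).
  destruct (pos_convex_path a N0 N1 Ha M0 C0 M1 C1) as (P & CP & E0 & E1 & HP).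
  destruct (cont01_charges P q1 q2 q4 Hq1 Hq2 Hq4 CP) as [Cs Ct]; [intros; now apply HP|].
  exists (fun tau => charge_s q1 q2 q4 (P tau)), (fun tau => charge_t q1 q2 q4 (P tau)), P.
  split; [exact Cs|split; [exact Ct|split; [exact CP|]]].
  split; [now apply congruent_trans with N0|split; [now apply congruent_trans with N1|]].
  intros tau Ht. destruct (HP tau Ht) as [HM HC].
  destruct (charges_stabilize a (P tau) q1 q2 q4) as (Hs & Htt & HU); auto.
  repeat split; auto; try apply HU. now apply pos_convex_strictly_convex.
Qed.
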